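(* Let $\Gamma$ be a nonelementary discrete subgroup of $\mathrm{Sp}(1,1)$. Then the trace field of $\Gamma$ is contained in $\mathbb R$ if and only if $\Gamma$ is conjugate to a subgroup of $\mathrm{SU}(1,1)$ by an element of $\mathrm{Sp}(1)$, i.e. there is a unit quaternion $h$ with $(hI_2)^{-1}\Gamma(hI_2)\subset\mathrm{SU}(1,1)$.
   Context: $\mathbb H$ denotes the quaternions. $\mathrm{Sp}(1,1)=\{A\in\mathrm{GL}(2,\mathbb H): A^*I_{1,1}A=I_{1,1}\}$, $I_{1,1}=\mathrm{diag}(1,-1)$, acting on quaternionic hyperbolic line $\mathbf H^1_{\mathbb H}$; nonelementary means the limit set in $\partial\mathbf H^1_{\mathbb H}$ has more than two points. $\mathrm{SU}(1,1)$ is the subgroup of complex matrices of determinant $1$ in $\mathrm{Sp}(1,1)$. $\mathrm{Sp}(1)$ is the group of unit quaternions $h$, identified with the scalar matrices $hI_2$. The trace of a matrix is the sum of its diagonal entries; the trace field of $\Gamma$ is the skew field generated over $\mathbb Q$ by the traces of its elements. *)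

(* Defs.v *)
From Stdlib Require Import Reals QArith.
Open Scope R_scope.

Record quat := Quat { q0 : R; q1 : R; q2 : R; q3 : R }.

Definition qR (r : R) : quat := Quat r 0 0 0.
Definition qzero : quat := qR 0.
Definition qone : quat := qR 1.

Definition qadd (x y : quat) : quat :=
  Quat (q0 x + q0 y) (q1 x + q1 y) (q2 x + q2 y) (q3 x + q3 y).
Definition qopp (x : quat) : quat := Quat (- q0 x) (- q1 x) (- q2 x) (- q3 x).
Definition qsub (x y : quat) : quat := qadd x (qopp y).

Definition qmul (x y : quat) : quat :=
  Quat (q0 x * q0 y - q1 x * q1 y - q2 x * q2 y - q3 x * q3 y)
       (q0 x * q1 y + q1 x * q0 y + q2 x * q3 y - q3 x * q2 y)
       (q0 x * q2 y - q1 x * q3 y + q2 x * q0 y + q3 x * q1 y)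
       (q0 x * q3 y + q1 x * q2 y - q2 x * q1 y + q3 x * q0 y).

Definition qconj (x : quat) : quat := Quat (q0 x) (- q1 x) (- q2 x) (- q3 x).
Definition qnorm2 (x : quat) : R := q0 x ^ 2 + q1 x ^ 2 + q2 x ^ 2 + q3 x ^ 2.
Definition qnorm (x : quat) : R := sqrt (qnorm2 x).
Definition qinv (x : quat) : quat :=
  let n := qnorm2 x in Quat (q0 x / n) (- q1 x / n) (- q2 x / n) (- q3 x / n).

Definition is_real_quat (x : quat) : Prop := q1 x = 0 /\ q2 x = 0 /\ q3 x = 0.
Definition is_complex_quat (x : quat) : Prop := q2 x = 0 /\ q3 x = 0.

Record mat2 := Mat2 { m11 : quat; m12 : quat; m21 : quat; m22 : quat }.

Definition mmul (A B : mat2) : mat2 :=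
  Mat2 (qadd (qmul (m11 A) (m11 B)) (qmul (m12 A) (m21 B)))
       (qadd (qmul (m11 A) (m12 B)) (qmul (m12 A) (m22 B)))
       (qadd (qmul (m21 A) (m11 B)) (qmul (m22 A) (m21 B)))
       (qadd (qmul (m21 A) (m12 B)) (qmul (m22 A) (m22 B))).

Definition madj (A : mat2) : mat2 :=
  Mat2 (qconj (m11 A)) (qconj (m21 A)) (qconj (m12 A)) (qconj (m22 A)).

Definition mone : mat2 := Mat2 qone qzero qzero qone.
Definition I11 : mat2 := Mat2 qone qzero qzero (qopp qone).
Definition mscal (h : quat) : mat2 := Mat2 h qzero qzero h.

Definition mtrace (A : mat2) : quat := qadd (m11 A) (m22 A).

Definition mdist (A B : mat2) : R :=
  sqrt (qnorm2 (qsub (m11 A) (m11 B)) + qnorm2 (qsub (m12 A) (m12 B))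
      + qnorm2 (qsub (m21 A) (m21 B)) + qnorm2 (qsub (m22 A) (m22 B))).

Definition in_Sp11 (A : mat2) : Prop := mmul (madj A) (mmul I11 A) = I11.

Definition in_SU11 (A : mat2) : Prop :=
  in_Sp11 A /\
  is_complex_quat (m11 A) /\ is_complex_quat (m12 A) /\
  is_complex_quat (m21 A) /\ is_complex_quat (m22 A) /\
  qsub (qmul (m11 A) (m22 A)) (qmul (m12 A) (m21 A)) = qone.

Definition is_subgroup_Sp11 (G : mat2 -> Prop) : Prop :=
  (forall g, G g -> in_Sp11 g) /\
  G mone /\
  (forall g h, G g -> G h -> G (mmul g h)) /\
  (forall g, G g -> exists g', G g' /\ mmul g g' = mone /\ mmul g' g = mone).

Definition discrete_set (G : mat2 -> Prop) : Prop :=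
  forall g, G g -> exists eps, 0 < eps /\
    forall g', G g' -> mdist g g' < eps -> g' = g.

(* Ball model: H^1_H = { q in H : |q| < 1 }  (the negative line spanned by
   the column vector (q,1)), boundary = { q : |q| = 1 } = S^3.
   A = [[a,b],[c,d]] acts by q |-> (a q + b)(c q + d)^{-1}. *)
Definition mact (A : mat2) (q : quat) : quat :=
  qmul (qadd (qmul (m11 A) q) (m12 A)) (qinv (qadd (qmul (m21 A) q) (m22 A))).

Definition in_limit_set (G : mat2 -> Prop) (p : quat) : Prop :=
  qnorm2 p = 1 /\
  forall eps, 0 < eps -> exists g, G g /\ qnorm (qsub (mact g qzero) p) < eps.

Definition nonelementary (G : mat2 -> Prop) : Prop :=
  exists p1 p2 p3, in_limit_set G p1 /\ in_limit_set G p2 /\ in_limit_set G p3 /\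
    p1 <> p2 /\ p1 <> p3 /\ p2 <> p3.

Inductive in_trace_field (G : mat2 -> Prop) : quat -> Prop :=
  | tf_rat : forall r : Q, in_trace_field G (qR (Q2R r))
  | tf_trace : forall g, G g -> in_trace_field G (mtrace g)
  | tf_add : forall x y, in_trace_field G x -> in_trace_field G y ->
      in_trace_field G (qadd x y)
  | tf_opp : forall x, in_trace_field G x -> in_trace_field G (qopp x)
  | tf_mul : forall x y, in_trace_field G x -> in_trace_field G y ->
      in_trace_field G (qmul x y)
  | tf_inv : forall x, in_trace_field G x -> x <> qzero ->
      in_trace_field G (qinv x).

(* Main.v *)
Require Import Defs.
From Stdlib Require Import Reals QArith.
From Stdlib Require Import Lra Lia Psatz Classical ClassicalEpsilon.
Open Scope R_scope.

(** Write [sigma M = I M^* I], so that [sigma g = g^-1] on Sp(1,1).  The real span A of G is a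
    sigma-stable algebra.  If all traces are real, every M in A is [x + X + Y] with
    [X = p D + q J + v S] fixed and [Y = s S + b D + c J] reversed by sigma, where
    [D = diag(1,-1)], [J = (0 1; -1 0)], [S = (0 1; 1 0)], the numbers p, q, s are real and v, b, c
    are imaginary quaternions; moreover X and Y lie in A.  Reality of the traces of products gives
    [p b - q c + s v = 0], [b x b' = c x c'] and [v x v' = 0] throughout A.

    The main point is that X = 0 for every g in G.  The relation [g g^-1 = 1] leaves two other
    possibilities.  If [X = v S] with v nonzero, the trace relations force G to be abelian; then each
    element fixes all limit points, and elements fixing three boundary points are bounded.
    Otherwise g = X is a point inversion; the trace relations say that the centres of its conjugates
    are collinear in the Klein model, and these centres accumulate at every limit point, which is
    impossible for three points of a sphere.

    Once X vanishes on G, products give [(b + c) x (b' - c') = 0].  Either all b, c are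
    multiples of one vector w, and a unit h rotating w to the complex axis conjugates G into SU(1,1),
    or [c = e b] on G for a sign e.  In the latter case G fixes a boundary point and acts by affine
    maps; by discreteness a hyperbolic element excludes nontrivial unipotents, hence G is abelian and
    the b are again parallel, whereas without hyperbolic elements there is only one limit point. *)

(** * Imaginary quaternions as vectors, and quaternionic matrices as a real algebra *)

Record vec := Vec { vx : R; vy : R; vz : R }.

Definition vzero : vec := Vec 0 0 0.
Definition vadd (u v : vec) : vec := Vec (vx u + vx v) (vy u + vy v) (vz u + vz v).
Definition vscal (t : R) (v : vec) : vec := Vec (t * vx v) (t * vy v) (t * vz v).
Definition vsub (u v : vec) : vec := vadd u (vscal (-1) v).
Definition dot (u v : vec) : R := vx u * vx v + vy u * vy v + vz u * vz v.
Definition cross (u v : vec) : vec :=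
  Vec (vy u * vz v - vz u * vy v) (vz u * vx v - vx u * vz v) (vx u * vy v - vy u * vx v).
Definition qvec (r : R) (v : vec) : quat := Quat r (vx v) (vy v) (vz v).

Definition madd (A B : mat2) : mat2 :=
  Mat2 (qadd (m11 A) (m11 B)) (qadd (m12 A) (m12 B))
       (qadd (m21 A) (m21 B)) (qadd (m22 A) (m22 B)).
Definition mscale (t : R) (A : mat2) : mat2 :=
  Mat2 (qmul (qR t) (m11 A)) (qmul (qR t) (m12 A))
       (qmul (qR t) (m21 A)) (qmul (qR t) (m22 A)).
Definition msig (A : mat2) : mat2 :=
  Mat2 (qconj (m11 A)) (qopp (qconj (m21 A))) (qopp (qconj (m12 A))) (qconj (m22 A)).

Definition Xm (p q : R) (v : vec) : mat2 :=
  Mat2 (qvec p vzero) (qvec q v) (qvec (- q) v) (qvec (- p) vzero).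
Definition Ym (s : R) (b c : vec) : mat2 :=
  Mat2 (qvec 0 b) (qvec s c) (qvec s (vscal (-1) c)) (qvec 0 (vscal (-1) b)).
Definition XYm (x p q : R) (v : vec) (s : R) (b c : vec) : mat2 :=
  madd (mscale x mone) (madd (Xm p q v) (Ym s b c)).

Lemma vec_eq (u v : vec) : vx u = vx v -> vy u = vy v -> vz u = vz v -> u = v.
Proof. destruct u, v; simpl; intros; subst; reflexivity. Qed.

Lemma quat_eq (x y : quat) :
  q0 x = q0 y -> q1 x = q1 y -> q2 x = q2 y -> q3 x = q3 y -> x = y.
Proof. destruct x, y; simpl; intros; subst; reflexivity. Qed.

Lemma mat2_eq (A B : mat2) :
  m11 A = m11 B -> m12 A = m12 B -> m21 A = m21 B -> m22 A = m22 B -> A = B.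
Proof. destruct A, B; simpl; intros; subst; reflexivity. Qed.

Ltac unfold_coords :=
  cbv [XYm Xm Ym madd mscale msig qvec mmul madj mone I11 mscal mtrace
       qadd qopp qsub qmul qconj qR qzero qone qnorm2 is_real_quat
       vsub vadd vscal dot cross vzero
       m11 m12 m21 m22 q0 q1 q2 q3 vx vy vz] in *.

Ltac coords_eq :=
  match goal with
  | |- @eq mat2 _ _ => apply mat2_eq; apply quat_eq
  | |- @eq quat _ _ => apply quat_eq
  | |- @eq vec _ _ => apply vec_eq
  | |- _ => idtac
  end; unfold_coords.

Ltac dest_all :=
  repeat match goal with
  | A : mat2 |- _ => destruct A
  | x : quat |- _ => destruct x
  | v : vec |- _ => destruct v
  end.

Ltac coords := intros; dest_all; coords_eq; try ring.

Lemma mmul_assoc (A B C : mat2) : mmul A (mmul B C) = mmul (mmul A B) C.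
Proof. coords. Qed.
Lemma mmul_1l (A : mat2) : mmul mone A = A.
Proof. coords. Qed.
Lemma mmul_1r (A : mat2) : mmul A mone = A.
Proof. coords. Qed.
Lemma mmul_addl (A B C : mat2) : mmul (madd A B) C = madd (mmul A C) (mmul B C).
Proof. coords. Qed.
Lemma mmul_addr (A B C : mat2) : mmul A (madd B C) = madd (mmul A B) (mmul A C).
Proof. coords. Qed.
Lemma mmul_scalel (t : R) (A B : mat2) : mmul (mscale t A) B = mscale t (mmul A B).
Proof. coords. Qed.
Lemma mmul_scaler (t : R) (A B : mat2) : mmul A (mscale t B) = mscale t (mmul A B).
Proof. coords. Qed.
Lemma msig_add (A B : mat2) : msig (madd A B) = madd (msig A) (msig B).
Proof. coords. Qed.
Lemma msig_scale (t : R) (A : mat2) : msig (mscale t A) = mscale t (msig A).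
Proof. coords. Qed.
Lemma msig_def (A : mat2) : msig A = mmul I11 (mmul (madj A) I11).
Proof. coords. Qed.
Lemma I11_sq : mmul I11 I11 = mone.
Proof. coords. Qed.

Lemma msig_mul_l (g : mat2) : in_Sp11 g -> mmul (msig g) g = mone.
Proof.
  intros H. unfold in_Sp11 in H. rewrite msig_def, <- !mmul_assoc, H. apply I11_sq.
Qed.

Lemma qnorm2_mul (x y : quat) : qnorm2 (qmul x y) = qnorm2 x * qnorm2 y.
Proof. coords. Qed.

(** * Real span of the group and the relations forced by real traces *)

Inductive rspan (G : mat2 -> Prop) : mat2 -> Prop :=
  | rspan_in : forall g, G g -> rspan G g
  | rspan_add : forall A B, rspan G A -> rspan G B -> rspan G (madd A B)
  | rspan_scale : forall t A, rspan G A -> rspan G (mscale t A).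

Record real_trace_algebra (A : mat2 -> Prop) : Prop := {
  rta_one : A mone;
  rta_add : forall M N, A M -> A N -> A (madd M N);
  rta_scale : forall t M, A M -> A (mscale t M);
  rta_mul : forall M N, A M -> A N -> A (mmul M N);
  rta_sig : forall M, A M -> A (msig M);
  rta_trace : forall M, A M -> is_real_quat (mtrace M) }.

Lemma subgroup_msig (G : mat2 -> Prop) (g : mat2) :
  is_subgroup_Sp11 G -> G g -> G (msig g) /\ mmul g (msig g) = mone /\ mmul (msig g) g = mone.
Proof.
  intros (Hsp & _ & _ & Hinv) Hg.
  destruct (Hinv g Hg) as (g' & Hg' & H1 & H2).
  pose proof (msig_mul_l g (Hsp g Hg)) as H3.
  assert (E : msig g = g').
  { rewrite <- (mmul_1r (msig g)), <- H1, mmul_assoc, H3. apply mmul_1l. }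
  rewrite E; auto.
Qed.

(** Real scalars are central, so products extend bilinearly and sigma linearly from the group to its
    span; the trace stays real because it is real linear. *)
Lemma rspan_real_trace_algebra (G : mat2 -> Prop) :
  is_subgroup_Sp11 G -> (forall g, G g -> is_real_quat (mtrace g)) ->
  real_trace_algebra (rspan G).
Proof.
  intros HG Htr. pose proof HG as (_ & H1 & Hmul & _). split.
  - apply rspan_in, H1.
  - apply rspan_add.
  - apply rspan_scale.
  - intros M N HM HN. induction HM as [g Hg | A B HA IHA HB IHB | t A HA IHA].
    + induction HN as [h Hh | A B HA IHA HB IHB | t A HA IHA].
      * apply rspan_in, Hmul; assumption.
      * rewrite mmul_addr. apply rspan_add; assumption.
      * rewrite mmul_scaler. apply rspan_scale; assumption.
    + rewrite mmul_addl. apply rspan_add; assumption.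
    + rewrite mmul_scalel. apply rspan_scale; assumption.
  - intros M HM. induction HM as [g Hg | A B HA IHA HB IHB | t A HA IHA].
    + apply rspan_in, (subgroup_msig G g HG Hg).
    + rewrite msig_add. apply rspan_add; assumption.
    + rewrite msig_scale. apply rspan_scale; assumption.
  - intros M HM. induction HM as [g Hg | A B HA IHA HB IHB | t A HA IHA].
    + apply Htr, Hg.
    + dest_all; unfold_coords; lra.
    + dest_all; unfold_coords; destruct IHA as (E1 & E2 & E3); repeat split; nra.
Qed.

(** Y is [(M - msig M) / 2], and X is [(M + msig M) / 2] minus its real scalar part x. Reality of
    the trace makes the imaginary parts of the diagonal entries opposite, as the shape [Ym]
    requires. *)
Lemma real_trace_decomp (A : mat2 -> Prop) (M : mat2) :
  real_trace_algebra A -> A M ->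
  exists x p q v s b c, M = XYm x p q v s b c /\ A (Xm p q v) /\ A (Ym s b c).
Proof.
  intros HA HM. pose proof (rta_trace A HA M HM) as Htr.
  destruct M as [[a0 a1 a2 a3] [b0 b1 b2 b3] [c0 c1 c2 c3] [d0 d1 d2 d3]].
  pose (M := Mat2 (Quat a0 a1 a2 a3) (Quat b0 b1 b2 b3) (Quat c0 c1 c2 c3) (Quat d0 d1 d2 d3)).
  exists ((a0 + d0) / 2), ((a0 - d0) / 2), ((b0 - c0) / 2),
    (Vec ((b1 + c1) / 2) ((b2 + c2) / 2) ((b3 + c3) / 2)), ((b0 + c0) / 2),
    (Vec a1 a2 a3), (Vec ((b1 - c1) / 2) ((b2 - c2) / 2) ((b3 - c3) / 2)).
  repeat split.
  - coords_eq; lra.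
  - replace (Xm _ _ _) with (madd (mscale (1/2) (madd M (msig M))) (mscale (- ((a0 + d0) / 2)) mone)).
    + apply HA; apply HA; [apply HA; [|apply HA] | apply HA]; exact HM.
    + unfold M; coords_eq; lra.
  - replace (Ym _ _ _) with (mscale (1/2) (madd M (mscale (-1) (msig M)))).
    + apply HA; apply HA; [|apply HA; apply HA]; exact HM.
    + unfold M; coords_eq; lra.
Qed.

(** The imaginary part of the trace of the product is twice the difference of the two sides, here
    and in the next two relations. *)
Lemma rta_XY (A : mat2 -> Prop) (p q s : R) (v b c : vec) :
  real_trace_algebra A -> A (Xm p q v) -> A (Ym s b c) ->
  vadd (vscal p b) (vscal s v) = vscal q c.
Proof.
  intros HA HX HY.
  pose proof (rta_trace A HA _ (rta_mul A HA _ _ HX HY)) as H1.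
  pose proof (rta_trace A HA _ (rta_mul A HA _ _ HY HX)) as H2.
  dest_all; coords_eq; lra.
Qed.

Lemma rta_YY (A : mat2 -> Prop) (s s' : R) (b c b' c' : vec) :
  real_trace_algebra A -> A (Ym s b c) -> A (Ym s' b' c') -> cross b b' = cross c c'.
Proof.
  intros HA HX HY.
  pose proof (rta_trace A HA _ (rta_mul A HA _ _ HX HY)) as H1.
  dest_all; coords_eq; lra.
Qed.

Lemma rta_XX (A : mat2 -> Prop) (p q p' q' : R) (v v' : vec) :
  real_trace_algebra A -> A (Xm p q v) -> A (Xm p' q' v') -> cross v v' = vzero.
Proof.
  intros HA HX HY.
  pose proof (rta_trace A HA _ (rta_mul A HA _ _ HX HY)) as H1.
  dest_all; coords_eq; lra.
Qed.

(** Since sigma reverses the order of products, it negates XY + YX and the commutator of two X, and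
    fixes the anticommutator of two Y. The trace relations cancel the unwanted terms, so that these
    are, up to real factors and scalars, a Y, a Y and an X, in this lemma and the next two. *)
Lemma rta_XY_anticomm (A : mat2 -> Prop) (p q s : R) (v b c : vec) :
  real_trace_algebra A -> A (Xm p q v) -> A (Ym s b c) ->
  A (Ym 0 (cross v c) (cross v b)).
Proof.
  intros HA HX HY. pose proof (rta_XY A p q s v b c HA HX HY) as H.
  apply (f_equal (fun w => (vx w, (vy w, vz w)))) in H. injection H; clear H; intros H3 H2 H1.
  replace (Ym _ _ _) with
    (mscale (-1/2) (madd (mmul (Xm p q v) (Ym s b c)) (mmul (Ym s b c) (Xm p q v)))).
  - repeat apply HA; assumption.
  - dest_all; coords_eq; lra.
Qed.

Lemma rta_XX_comm (A : mat2 -> Prop) (p q p' q' : R) (v v' : vec) :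
  real_trace_algebra A -> A (Xm p q v) -> A (Xm p' q' v') ->
  A (Ym (p * q' - p' * q) (vsub (vscal q v') (vscal q' v)) (vsub (vscal p v') (vscal p' v))).
Proof.
  intros HA HX HY. pose proof (rta_XX A p q p' q' v v' HA HX HY) as H.
  apply (f_equal (fun w => (vx w, (vy w, vz w)))) in H. injection H; clear H; intros H3 H2 H1.
  replace (Ym _ _ _) with
    (mscale (1/2) (madd (mmul (Xm p q v) (Xm p' q' v')) (mscale (-1) (mmul (Xm p' q' v') (Xm p q v))))).
  - repeat apply HA; assumption.
  - dest_all; coords_eq; lra.
Qed.

Lemma rta_YY_anticomm (A : mat2 -> Prop) (s s' : R) (b c b' c' : vec) :
  real_trace_algebra A -> A (Ym s b c) -> A (Ym s' b' c') ->
  A (Xm 0 0 (vadd (cross b c') (cross b' c))).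
Proof.
  intros HA HX HY. pose proof (rta_YY A s s' b c b' c' HA HX HY) as H.
  apply (f_equal (fun w => (vx w, (vy w, vz w)))) in H. injection H; clear H; intros H3 H2 H1.
  replace (Xm _ _ _) with
    (madd (mscale (1/2) (madd (mmul (Ym s b c) (Ym s' b' c')) (mmul (Ym s' b' c') (Ym s b c))))
      (mscale (- (s * s' - dot b b' + dot c c')) mone)).
  - apply HA; repeat apply HA; assumption.
  - dest_all; coords_eq; lra.
Qed.

(** * Matrix relations of Sp(1,1) and vector identities *)

(** With g = x + X + Y and sigma g = x + X - Y, the two equations amount to (x + X)^2 - Y^2 = 1 and
    XY = YX. Here X^2 is the real scalar p^2 - q^2 - |v|^2, while Y^2 has a component 2 (b x c)
    S. *)
Lemma sp11_relations (x p q s : R) (v b c : vec) :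
  let g := XYm x p q v s b c in
  mmul g (msig g) = mone -> mmul (msig g) g = mone ->
  x * p = 0 /\ x * q = 0 /\ vscal x v = cross b c /\
  x^2 + p^2 + dot b b = 1 + q^2 + dot v v + s^2 + dot c c /\
  q * s + dot v c = 0 /\ p * s + dot v b = 0 /\ vscal p c = vscal q b.
Proof.
  intros g H1 H2. unfold g in *. clear g. dest_all. unfold_coords.
  injection H1; clear H1; intros.
  injection H2; clear H2; intros.
  repeat split; try (apply vec_eq; simpl); lra.
Qed.

Lemma vec_components (u v : vec) : u = v -> vx u = vx v /\ vy u = vy v /\ vz u = vz v.
Proof. intros ->; auto. Qed.

Lemma dot_comm (u v : vec) : dot u v = dot v u.
Proof. coords. Qed.

Lemma dot_scal_r (t : R) (u v : vec) : dot u (vscal t v) = t * dot u v.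
Proof. coords. Qed.

Lemma dot_self_ge0 (v : vec) : 0 <= dot v v.
Proof. unfold dot; nra. Qed.

Lemma dot_self_eq0 (v : vec) : dot v v = 0 -> v = vzero.
Proof. intros H; unfold dot in H; apply vec_eq; simpl; nra. Qed.

Lemma dot_self_gt0 (v : vec) : v <> vzero -> 0 < dot v v.
Proof.
  intros H. destruct (dot_self_ge0 v) as [H1 | H1]; [exact H1 |].
  exfalso; apply H, dot_self_eq0; auto.
Qed.

Lemma vscal_eq0 (t : R) (v : vec) : t <> 0 -> vscal t v = vzero -> v = vzero.
Proof.
  intros Ht H. apply vec_components in H. destruct v; unfold vscal, vzero in *; simpl in *.
  apply vec_eq; simpl; nra.
Qed.

Lemma vscal_eq0_l (t : R) (v : vec) : v <> vzero -> vscal t v = vzero -> t = 0.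
Proof.
  intros Hv H. destruct (Req_dec t 0) as [| Ht]; [assumption |].
  exfalso; apply Hv, (vscal_eq0 t v Ht H).
Qed.

(** Sum and difference of the two equations read (x - y)(b + c) = 0 and (x + y)(b - c) = 0. *)
Lemma vscal_swap_eq0 (x y : R) (b c : vec) :
  vsub b c <> vzero -> vadd b c <> vzero ->
  vscal x b = vscal y c -> vscal x c = vscal y b -> x = 0 /\ y = 0.
Proof.
  intros Hm Hp E1 E2. apply vec_components in E1, E2.
  assert (x - y = 0).
  { apply (vscal_eq0_l _ (vadd b c) Hp). destruct b, c; unfold_coords; apply vec_eq; simpl; lra. }
  assert (x + y = 0).
  { apply (vscal_eq0_l _ (vsub b c) Hm). destruct b, c; unfold_coords; apply vec_eq; simpl; lra. }
  lra.
Qed.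

Lemma cross_cross (u v w : vec) :
  cross u (cross v w) = vsub (vscal (dot u w) v) (vscal (dot u v) w).
Proof. coords. Qed.

Lemma cross_eq0_parallel (u v : vec) :
  u <> vzero -> cross u v = vzero -> v = vscal (dot u v / dot u u) u.
Proof.
  intros Hu H. apply dot_self_gt0 in Hu.
  pose proof (cross_cross u u v) as E. rewrite H in E. apply vec_components in E.
  destruct u as [a b c], v as [d e f]; unfold_coords.
  apply vec_eq; simpl; apply (Rmult_eq_reg_l (a * a + b * b + c * c)); try lra;
    (match goal with |- _ = ?N * (?D / ?N * ?t) => replace (N * (D / N * t)) with (D * t) by (field; lra) end);
    nra.
Qed.

(** * Possible X parts of a group element *)

(** For x nonzero, p = q = 0 is immediate. For x = p = 0 and q nonzero, Y vanishes and the norm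
    relation reads 0 = 1 + q^2 + |v|^2. For x = 0 and p nonzero, the norm relation becomes X^2 = 1,
    and this forces Y = 0. *)
Lemma sp11_real_trace_cases (A : mat2 -> Prop) (x p q s : R) (v b c : vec) :
  real_trace_algebra A -> A (Xm p q v) -> A (Ym s b c) ->
  let g := XYm x p q v s b c in
  mmul g (msig g) = mone -> mmul (msig g) g = mone ->
  (p = 0 /\ q = 0) \/ (p <> 0 /\ x = 0 /\ s = 0 /\ b = vzero /\ c = vzero).
Proof.
  intros HA HX HY g H1 H2.
  pose proof (rta_XY A p q s v b c HA HX HY) as HR.
  destruct (sp11_relations x p q s v b c H1 H2) as (Exp & Exq & _ & En & Eqs & Eps & Epc).
  destruct (Req_dec x 0) as [-> | Hx]; [| left; split; nra].
  pose proof (dot_self_ge0 v) as Hv.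
  pose proof (vec_components _ _ HR) as HRc. pose proof (vec_components _ _ Epc) as Epcc.
  destruct (Req_dec p 0) as [-> | Hp].
  - left; split; [reflexivity |].
    destruct (Req_dec q 0) as [| Hq]; [assumption | exfalso].
    assert (b = vzero) as ->.
    { destruct b; unfold vscal, vzero in *; simpl in *; apply vec_eq; simpl; nra. }
    assert (Hs : s * (q ^ 2 + dot v v) = 0).
    { destruct v, c; unfold vscal, vadd, vzero, dot in *; simpl in *; nra. }
    assert (s = 0) as -> by (destruct (Rmult_integral _ _ Hs); nra).
    assert (c = vzero) as ->.
    { destruct c; unfold vscal, vadd, vzero in *; simpl in *; apply vec_eq; simpl; nra. }
    unfold vzero, dot in *; simpl in *; nra.
  - right.
    (* Multiply p b + s v = q c by p and substitute p c = q b and p s = - v.b; this eliminates c and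
       s. *)
    assert (Hb : vscal (p ^ 2 - q ^ 2) b = vscal (dot v b) v).
    { destruct HRc as (R1 & R2 & R3), Epcc as (P1 & P2 & P3), v as [v1 v2 v3], b, c.
      unfold vscal, vadd, dot in *; simpl in *.
      apply (f_equal (Rmult p)) in R1, R2, R3.
      apply (f_equal (Rmult q)) in P1, P2, P3.
      pose proof (f_equal (Rmult v1) Eps). pose proof (f_equal (Rmult v2) Eps).
      pose proof (f_equal (Rmult v3) Eps). apply vec_eq; simpl; lra. }
    assert (Hbb : (p ^ 2 - q ^ 2) * dot b b = dot v b ^ 2).
    { apply (f_equal (dot b)) in Hb. rewrite !dot_scal_r, (dot_comm b v) in Hb. lra. }
    assert (Hbv : (p ^ 2 - q ^ 2) * dot v b = dot v b * dot v v).
    { apply (f_equal (dot v)) in Hb. rewrite !dot_scal_r in Hb. lra. }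
    assert (Hcc : p ^ 2 * dot c c = q ^ 2 * dot b b).
    { apply (f_equal (fun w => dot w w)) in Epc.
      rewrite !dot_scal_r, !(dot_comm (vscal _ _)), !dot_scal_r in Epc. lra. }
    (* In p^2 times the norm relation the terms in b, s and c cancel by [Hbb] and [Hcc]. *)
    assert (HX1 : p ^ 2 - q ^ 2 - dot v v = 1).
    { apply (Rmult_eq_reg_l (p ^ 2)); [| nra].
      assert (p ^ 2 * s ^ 2 = dot v b ^ 2) by nra. nra. }
    assert (Hvb : dot v b = 0) by nra.
    assert (b = vzero) as -> by (apply dot_self_eq0; nra).
    assert (c = vzero) as ->.
    { apply dot_self_eq0. unfold vzero, dot in *; simpl in *; nra. }
    repeat split; auto; nra.
Qed.

(** * Elements whose X part is v S *)

(** The trace relation reduces to s v = 0. If b = c or b = -c, then x v = b x c = 0, so x = 0 and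
    the norm relation becomes 0 = 1 + |v|^2. *)
Lemma sp11_skew_X (A : mat2 -> Prop) (x s : R) (v b c : vec) :
  real_trace_algebra A -> A (Xm 0 0 v) -> A (Ym s b c) -> v <> vzero ->
  let g := XYm x 0 0 v s b c in
  mmul g (msig g) = mone -> mmul (msig g) g = mone ->
  s = 0 /\ dot v b = 0 /\ dot v c = 0 /\ vsub b c <> vzero /\ vadd b c <> vzero.
Proof.
  intros HA HX HY Hv g H1 H2.
  pose proof (rta_XY A 0 0 s v b c HA HX HY) as HR.
  destruct (sp11_relations x 0 0 s v b c H1 H2) as (_ & _ & Exv & En & Eqs & Eps & _).
  assert (Hs : s = 0).
  { apply (vscal_eq0_l s v Hv). apply vec_components in HR. dest_all; coords_eq; lra. }
  subst s. apply dot_self_gt0 in Hv.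
  assert (K : forall t, t * t = 1 -> b = vscal t c -> False).
  { intros t Ht ->.
    assert (Hx : vscal x v = vzero) by (rewrite Exv; coords).
    apply (f_equal (dot v)) in Hx. rewrite dot_scal_r in Hx.
    replace (dot v vzero) with 0 in Hx by coords.
    rewrite dot_scal_r, (dot_comm (vscal t c)), dot_scal_r, <- Rmult_assoc, Ht in En.
    destruct (Rmult_integral _ _ Hx); nra. }
  repeat split; try lra; intros E; apply vec_components in E;
    [apply (K 1) | apply (K (-1))]; try lra; dest_all; coords_eq; lra.
Qed.

Lemma cross_orth_parallel (v b b' c c' : vec) :
  dot v b = 0 -> dot v c = 0 -> cross b' b = cross c' c ->
  vscal (dot v b') b = vscal (dot v c') c.
Proof.
  intros Hb Hc H. apply (f_equal (cross v)) in H. rewrite !cross_cross, Hb, Hc in H.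
  apply vec_components in H. dest_all. coords_eq; lra.
Qed.

Lemma cross_orth_inj (v b c : vec) (x y : R) :
  v <> vzero -> dot v b = 0 -> dot v c = 0 ->
  vscal x (cross v b) = vscal y (cross v c) -> vscal x b = vscal y c.
Proof.
  intros Hv Hb Hc H. apply dot_self_gt0 in Hv.
  assert (E : vscal (dot v v) (vsub (vscal x b) (vscal y c)) = vzero).
  { apply (f_equal (cross v)) in H.
    transitivity (vsub (cross v (vscal y (cross v c))) (cross v (vscal x (cross v b)))).
    - replace (cross v (vscal y (cross v c))) with (vscal y (cross v (cross v c))) by coords.
      replace (cross v (vscal x (cross v b))) with (vscal x (cross v (cross v b))) by coords.
      rewrite !cross_cross, Hb, Hc. coords.
    - rewrite H. coords. }
  apply vscal_eq0 in E; [| lra]. apply vec_components in E. dest_all; coords_eq; lra.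
Qed.

Lemma dot_cross_l (u v : vec) : dot u (cross u v) = 0.
Proof. coords. Qed.

(** The anticommutator of X and Y supplies a companion of Y with vectors v x c and v x b. Testing
    another element against Y and its companion gives x b = y c and x c = y b, where (x, y) is
    (v.b', v.c') or (p, q); as b differs from c and -c, both numbers vanish. *)
Lemma skew_X_forces_planar (A : mat2 -> Prop) (v b c : vec) :
  real_trace_algebra A -> A (Xm 0 0 v) -> A (Ym 0 b c) -> v <> vzero ->
  dot v b = 0 -> dot v c = 0 -> vsub b c <> vzero -> vadd b c <> vzero ->
  (forall s b' c', A (Ym s b' c') -> s = 0 /\ dot v b' = 0 /\ dot v c' = 0) /\
  (forall p q v', A (Xm p q v') -> p = 0 /\ q = 0).
Proof.
  intros HA HX HY Hv Hb Hc Hm Hp.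
  pose proof (rta_XY_anticomm A _ _ _ _ _ _ HA HX HY) as HY1.
  split.
  - intros s b' c' HY'.
    pose proof (rta_XY A _ _ _ _ _ _ HA HX HY') as E0.
    pose proof (rta_YY A _ _ _ _ _ _ HA HY' HY) as E1.
    pose proof (rta_YY A _ _ _ _ _ _ HA HY' HY1) as E2.
    apply (cross_orth_parallel v) in E1; [| assumption ..].
    apply (cross_orth_parallel v) in E2; [| apply dot_cross_l ..].
    apply cross_orth_inj in E2; [| assumption ..].
    split; [| exact (vscal_swap_eq0 _ _ b c Hm Hp E1 E2)].
    apply (vscal_eq0_l s v Hv). apply vec_components in E0. dest_all; coords_eq; lra.
  - intros p q v' HX'.
    pose proof (rta_XY A _ _ _ _ _ _ HA HX' HY) as E1.
    pose proof (rta_XY A _ _ _ _ _ _ HA HX' HY1) as E2.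
    apply (vscal_swap_eq0 p q b c Hm Hp).
    + rewrite <- E1. coords.
    + apply (cross_orth_inj v); try assumption. rewrite <- E2. coords.
Qed.

(** When all vectors are orthogonal to v, the commutator of g and h only involves b x b' - c x c'
    and b.c' - c.b'. The trace relation of the two Y kills the first, that of the first Y with the
    companion of the second kills the other. *)
Lemma planar_commute (A : mat2 -> Prop) (v b c b' c' : vec) (x k x' k' : R) :
  real_trace_algebra A -> A (Xm 0 0 v) -> v <> vzero ->
  A (Ym 0 b c) -> A (Ym 0 b' c') ->
  dot v b = 0 -> dot v c = 0 -> dot v b' = 0 -> dot v c' = 0 ->
  let g := XYm x 0 0 (vscal k v) 0 b c in
  let h := XYm x' 0 0 (vscal k' v) 0 b' c' in
  mmul g h = mmul h g.
Proof.
  intros HA HX Hv HY HY' Hb Hc Hb' Hc'; cbv zeta.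
  pose proof (rta_XY_anticomm A _ _ _ _ _ _ HA HX HY') as HY1.
  pose proof (rta_YY A _ _ _ _ _ _ HA HY HY') as E1.
  pose proof (rta_YY A _ _ _ _ _ _ HA HY HY1) as E2.
  rewrite !cross_cross, (dot_comm b v), (dot_comm c v), Hb, Hc in E2.
  assert (E3 : dot b c' = dot c b').
  { cut (dot b c' - dot c b' = 0); [lra |]. apply (vscal_eq0_l _ v Hv).
    apply vec_components in E2. dest_all; coords_eq; lra. }
  apply vec_components in E1. clear E2 HX HY HY' HY1 HA Hv.
  apply (f_equal (Rmult k')) in Hb, Hc. apply (f_equal (Rmult k)) in Hb', Hc'.
  dest_all; coords_eq; lra.
Qed.

(** * Convergence of quaternion sequences *)

Definition qlim (u : nat -> quat) (l : quat) : Prop :=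
  Un_cv (fun n => q0 (u n)) (q0 l) /\ Un_cv (fun n => q1 (u n)) (q1 l) /\
  Un_cv (fun n => q2 (u n)) (q2 l) /\ Un_cv (fun n => q3 (u n)) (q3 l).

Lemma Un_cv_const (r : R) : Un_cv (fun _ => r) r.
Proof. intros e He. exists 0%nat. intros. rewrite Rdist_eq. exact He. Qed.

Ltac un_cv :=
  lazymatch goal with
  | |- Un_cv (fun n => _ + _) _ => eapply CV_plus; un_cv
  | |- Un_cv (fun n => _ - _) _ => eapply CV_minus; un_cv
  | |- Un_cv (fun n => _ * _) _ => eapply CV_mult; un_cv
  | |- Un_cv (fun n => - _) _ => eapply CV_opp; un_cv
  | |- _ => first [eassumption | apply Un_cv_const]
  end.

Lemma qlim_const (x : quat) : qlim (fun _ => x) x.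
Proof. repeat split; apply Un_cv_const. Qed.

Lemma qlim_add (u w : nat -> quat) (x y : quat) :
  qlim u x -> qlim w y -> qlim (fun n => qadd (u n) (w n)) (qadd x y).
Proof. intros (? & ? & ? & ?) (? & ? & ? & ?). repeat split; simpl; un_cv. Qed.

Lemma qlim_opp (u : nat -> quat) (x : quat) : qlim u x -> qlim (fun n => qopp (u n)) (qopp x).
Proof. intros (? & ? & ? & ?). repeat split; simpl; un_cv. Qed.

Lemma qlim_sub (u w : nat -> quat) (x y : quat) :
  qlim u x -> qlim w y -> qlim (fun n => qsub (u n) (w n)) (qsub x y).
Proof. intros Hu Hw. apply qlim_add; [| apply qlim_opp]; assumption. Qed.

Lemma qlim_conj (u : nat -> quat) (x : quat) : qlim u x -> qlim (fun n => qconj (u n)) (qconj x).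
Proof. intros (? & ? & ? & ?). repeat split; simpl; un_cv. Qed.

Lemma qlim_mul (u w : nat -> quat) (x y : quat) :
  qlim u x -> qlim w y -> qlim (fun n => qmul (u n) (w n)) (qmul x y).
Proof. intros (? & ? & ? & ?) (? & ? & ? & ?). repeat split; simpl; un_cv. Qed.

Lemma qlim_norm2 (u : nat -> quat) (x : quat) :
  qlim u x -> Un_cv (fun n => qnorm2 (u n)) (qnorm2 x).
Proof. intros (? & ? & ? & ?). unfold qnorm2; simpl; un_cv. Qed.

Lemma qnorm2_ge0 (x : quat) : 0 <= qnorm2 x.
Proof. unfold qnorm2; nra. Qed.

Lemma qnorm2_eq0 (x : quat) : qnorm2 x = 0 -> x = qzero.
Proof. intros H; unfold qnorm2 in H; apply quat_eq; simpl; nra. Qed.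

Lemma Un_cv_le (u w : nat -> R) (l m : R) :
  Un_cv u l -> Un_cv w m -> (forall n, u n <= w n) -> l <= m.
Proof.
  intros Hu Hw H. destruct (Rle_or_lt l m) as [| Hlt]; [assumption | exfalso].
  destruct (Hu ((l - m) / 2)) as [N1 H1]; [lra |].
  destruct (Hw ((l - m) / 2)) as [N2 H2]; [lra |].
  specialize (H1 (N1 + N2)%nat ltac:(lia)). specialize (H2 (N1 + N2)%nat ltac:(lia)).
  specialize (H (N1 + N2)%nat). unfold Rdist in *.
  apply Rabs_def2 in H1, H2. lra.
Qed.

Lemma qlim_eq0 (u : nat -> quat) (x : quat) (e : nat -> R) :
  qlim u x -> Un_cv e 0 -> (forall n, qnorm2 (u n) <= e n) -> x = qzero.
Proof.
  intros Hu He H. apply qnorm2_eq0, Rle_antisym; [| apply qnorm2_ge0].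
  exact (Un_cv_le _ _ _ _ (qlim_norm2 _ _ Hu) He H).
Qed.

Lemma qlim_of_dist (u : nat -> quat) (x : quat) (e : nat -> R) :
  Un_cv e 0 -> (forall n, qnorm2 (qsub (u n) x) <= e n) -> qlim u x.
Proof.
  intros He H.
  assert (K : forall f : quat -> R, (forall n, (f (u n) - f x) ^ 2 <= qnorm2 (qsub (u n) x)) ->
    Un_cv (fun n => f (u n)) (f x)).
  { intros f Hf eps Heps. destruct (He (eps ^ 2)) as [N HN]; [nra |].
    exists N. intros n Hn. specialize (HN n Hn). specialize (H n). specialize (Hf n).
    unfold Rdist in *. apply Rabs_def2 in HN.
    apply Rabs_def1; apply Rnot_le_lt; intros Hle; nra. }
  repeat split; apply K; intros n; destruct (u n) as [a b c d], x as [a' b' c' d']; unfold_coords;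
    pose proof (pow2_ge_0 (a - a')); pose proof (pow2_ge_0 (b - b'));
    pose proof (pow2_ge_0 (c - c')); pose proof (pow2_ge_0 (d - d')); lra.
Qed.

Lemma is_real_qlim (u : nat -> quat) (x : quat) :
  qlim u x -> (forall n, is_real_quat (u n)) -> is_real_quat x.
Proof.
  intros (_ & H1 & H2 & H3) H. unfold is_real_quat in H.
  repeat split; (eapply UL_sequence; [eassumption |]);
    intros e He; exists 0%nat; intros n _; destruct (H n) as (E1 & E2 & E3);
    rewrite ?E1, ?E2, ?E3, Rdist_eq; exact He.
Qed.

Lemma limit_set_seq (G : mat2 -> Prop) (P : quat) :
  in_limit_set G P ->
  exists g : nat -> mat2, (forall n, G (g n)) /\ qlim (fun n => mact (g n) qzero) P.
Proof.
  intros [_ H].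
  assert (K : forall n : nat, exists g, G g /\ qnorm (qsub (mact g qzero) P) < / INR (S n)).
  { intros n. apply H, Rinv_0_lt_compat, lt_0_INR. lia. }
  exists (fun n => proj1_sig (constructive_indefinite_description _ (K n))).
  split; [intros n; exact (proj1 (proj2_sig (constructive_indefinite_description _ (K n)))) |].
  apply (qlim_of_dist _ _ (fun n => / INR (S n) * / INR (S n))).
  - replace 0 with (0 * 0) by ring. apply CV_mult.
    all: intros e He; destruct (archimed_cor1 e He) as [N [HN HN0]]; exists N; intros n Hn;
      unfold Rdist; rewrite Rminus_0_r, Rabs_pos_eq;
      [| left; apply Rinv_0_lt_compat, lt_0_INR; lia];
      (eapply Rle_lt_trans; [| exact HN]);
      (apply Rinv_le_contravar; [apply lt_0_INR; lia | apply le_INR; lia]).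
  - intros n. destruct (constructive_indefinite_description _ (K n)) as [g [Hg Hn]]; simpl proj1_sig.
    unfold qnorm in Hn. pose proof (sqrt_pos (qnorm2 (qsub (mact g qzero) P))).
    rewrite <- (sqrt_sqrt _ (qnorm2_ge0 (qsub (mact g qzero) P))). nra.
Qed.

(** * The orbit of the origin *)

Lemma sp11_entries (g : mat2) :
  mmul g (msig g) = mone -> mmul (msig g) g = mone ->
  qnorm2 (m22 g) = 1 + qnorm2 (m12 g) /\ qnorm2 (m12 g) = qnorm2 (m21 g) /\
  qnorm2 (m11 g) = qnorm2 (m22 g) /\
  qmul (m11 g) (qconj (m21 g)) = qmul (m12 g) (qconj (m22 g)) /\
  qsub (qmul (qconj (m11 g)) (m11 g)) (qmul (qconj (m21 g)) (m21 g)) = qone /\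
  qsub (qmul (qconj (m22 g)) (m22 g)) (qmul (qconj (m12 g)) (m12 g)) = qone /\
  qmul (qconj (m11 g)) (m12 g) = qmul (qconj (m21 g)) (m22 g).
Proof.
  intros H1 H2. dest_all. unfold_coords.
  injection H1; clear H1; intros. injection H2; clear H2; intros.
  repeat split; try apply quat_eq; simpl; lra.
Qed.

Lemma mact_zero (g : mat2) : mact g qzero = qmul (m12 g) (qinv (m22 g)).
Proof.
  unfold mact. f_equal; [| f_equal]; coords.
Qed.

Lemma mact_zero_mul (g : mat2) :
  qnorm2 (m22 g) <> 0 -> qmul (mact g qzero) (m22 g) = m12 g.
Proof.
  intros H. rewrite mact_zero. destruct g as [? [b0 b1 b2 b3] ? [d0 d1 d2 d3]].
  unfold qinv. coords_eq; field; exact H.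
Qed.

(** For o = b d^-1, |o|^2 |d|^2 = |b|^2 = |d|^2 - 1. Thus 1 - |o|^2 = 1/|d|^2 is the small parameter
    of the later estimates near the boundary. *)
Lemma mact_zero_norm (g : mat2) :
  mmul g (msig g) = mone -> mmul (msig g) g = mone ->
  (1 - qnorm2 (mact g qzero)) * qnorm2 (m22 g) = 1.
Proof.
  intros H1 H2. destruct (sp11_entries g H1 H2) as (E & _).
  pose proof (qnorm2_ge0 (m12 g)).
  assert (F : qmul (mact g qzero) (m22 g) = m12 g) by (apply mact_zero_mul; lra).
  apply (f_equal qnorm2) in F. rewrite qnorm2_mul in F. lra.
Qed.

(** The second column of g is (o, 1) d; this measures how far the first column is from that line.
    The defect t a, with t = 1 - |o|^2, has squared norm t, because |a|^2 = |d|^2 = 1/t. *)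
Lemma mact_zero_col (g : mat2) :
  mmul g (msig g) = mone -> mmul (msig g) g = mone ->
  qsub (m11 g) (qmul (mact g qzero) (m21 g)) =
  qmul (qR (1 - qnorm2 (mact g qzero))) (m11 g).
Proof.
  intros H1 H2. pose proof (mact_zero_norm g H1 H2) as HN.
  destruct (sp11_entries g H1 H2) as (E1 & E2 & E3 & E4 & _).
  pose proof (qnorm2_ge0 (m12 g)).
  assert (F : qmul (mact g qzero) (m22 g) = m12 g) by (apply mact_zero_mul; lra).
  set (o := mact g qzero) in *. set (t := 1 - qnorm2 o) in *.
  (* [a c^* = b d^* = o |d|^2] and [|c|^2 = |d|^2 - 1] *)
  assert (E : qmul (qR (qnorm2 (m21 g))) (m11 g) = qmul (qR (qnorm2 (m22 g))) (qmul o (m21 g))).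
  { transitivity (qmul (qmul (m11 g) (qconj (m21 g))) (m21 g)); [coords |].
    rewrite E4, <- F. coords. }
  replace (qmul o (m21 g)) with (qmul (qR t) (qmul (qR (qnorm2 (m21 g))) (m11 g))).
  - assert (K : t * qnorm2 (m21 g) = 1 - t) by (rewrite <- E2; rewrite E1 in HN; lra).
    transitivity (qsub (m11 g) (qmul (qR (t * qnorm2 (m21 g))) (m11 g))); [coords |].
    rewrite K. coords.
  - rewrite E. transitivity (qmul (qR (t * qnorm2 (m22 g))) (qmul o (m21 g))); [coords |].
    rewrite HN. coords.
Qed.

Lemma orbit_norm_cv (P : quat) (u : nat -> quat) :
  qnorm2 P = 1 -> qlim u P -> Un_cv (fun n => 1 - qnorm2 (u n)) 0.
Proof.
  intros HP Hu. replace 0 with (1 - qnorm2 P) by lra.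
  apply CV_minus; [apply Un_cv_const | apply qlim_norm2, Hu].
Qed.

(** * Limit points of commutative groups *)

(** The zeros of [f] are the solutions of the fixed point equation. For an orbit point o of k, the
    second columns of g k = k g give |f(o)| = (1 - |o|^2) |b|, with b the upper right entry of g;
    this tends to 0 as o approaches P. *)
Lemma commuting_fixes_limit_point (G : mat2 -> Prop) (g : mat2) (P : quat) :
  is_subgroup_Sp11 G -> in_limit_set G P -> (forall k, G k -> mmul g k = mmul k g) ->
  qadd (qmul (m11 g) P) (m12 g) = qmul P (qadd (qmul (m21 g) P) (m22 g)).
Proof.
  intros HG HP Hcomm. destruct (limit_set_seq G P HP) as (k & Hk & Hlim).
  destruct HP as [HP1 _]. pose proof (orbit_norm_cv P _ HP1 Hlim) as He.
  set (f := fun o => qsub (qadd (qmul (m11 g) o) (m12 g)) (qmul o (qadd (qmul (m21 g) o) (m22 g)))).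
  assert (H0 : f P = qzero).
  { apply (qlim_eq0 (fun n => f (mact (k n) qzero)) _
      (fun n => qnorm2 (m12 g) * ((1 - qnorm2 (mact (k n) qzero)) * (1 - qnorm2 (mact (k n) qzero))))).
    - unfold f. repeat (apply qlim_sub || apply qlim_add || apply qlim_mul || assumption || apply qlim_const).
    - replace 0 with (qnorm2 (m12 g) * (0 * 0)) by ring.
      apply CV_mult; [apply Un_cv_const | apply CV_mult; exact He].
    - intros n. destruct (subgroup_msig G (k n) HG (Hk n)) as (_ & H1 & H2).
      specialize (Hcomm (k n) (Hk n)).
      pose proof (mact_zero_norm _ H1 H2) as HN. pose proof (mact_zero_col _ H1 H2) as HC.
      destruct (sp11_entries _ H1 H2) as (E1 & E2 & E3 & _).
      pose proof (qnorm2_ge0 (m12 (k n))).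
      assert (F : qmul (mact (k n) qzero) (m22 (k n)) = m12 (k n)) by (apply mact_zero_mul; lra).
      remember (k n) as kn eqn:Hkn. clear Hkn. set (o := mact kn qzero) in *.
      assert (K : qmul (f o) (m22 kn) = qmul (qmul (qR (1 - qnorm2 o)) (m11 kn)) (m12 g)).
      { rewrite <- HC.
        transitivity (qsub (m12 (mmul g kn)) (qmul o (m22 (mmul g kn)))).
        - unfold mmul; simpl m12; simpl m22. rewrite <- F. unfold f. clear. coords.
        - rewrite Hcomm. unfold mmul; simpl m12; simpl m22. rewrite <- F. clear. coords. }
      apply (f_equal qnorm2) in K. rewrite !qnorm2_mul, E3 in K.
      replace (qnorm2 (qR (1 - qnorm2 o))) with ((1 - qnorm2 o) * (1 - qnorm2 o)) in K
        by (generalize (qnorm2 o); intros; coords).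
      apply Req_le, (Rmult_eq_reg_r (qnorm2 (m22 kn))); nra. }
  unfold f in H0. generalize dependent (qmul P (qadd (qmul (m21 g) P) (m22 g))).
  generalize (qadd (qmul (m11 g) P) (m12 g)). clear. intros x y H. destruct x, y. unfold_coords.
  injection H; intros. apply quat_eq; simpl; lra.
Qed.

(** The expression P^* Q - 1 is the Hermitian form on the vectors (P, 1) and (Q, 1). The hypotheses
    say that g multiplies them on the right by [bot P] and [bot Q], and g preserves the form. *)
Lemma sp11_form (g : mat2) (P Q : quat) :
  mmul g (msig g) = mone -> mmul (msig g) g = mone ->
  let top x := qadd (qmul (m11 g) x) (m12 g) in
  let bot x := qadd (qmul (m21 g) x) (m22 g) in
  top P = qmul P (bot P) -> top Q = qmul Q (bot Q) ->
  qmul (qconj (bot P)) (qmul (qsub (qmul (qconj P) Q) qone) (bot Q)) =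
  qsub (qmul (qconj P) Q) qone.
Proof.
  intros H1 H2 top bot HP HQ.
  destruct (sp11_entries g H1 H2) as (_ & _ & _ & _ & R1 & R2 & R3).
  transitivity (qsub (qmul (qconj (top P)) (top Q)) (qmul (qconj (bot P)) (bot Q))).
  { rewrite HP, HQ. generalize (bot P) (bot Q). clear. coords. }
  transitivity (qsub
    (qadd (qmul (qconj P) (qmul (qsub (qmul (qconj (m11 g)) (m11 g)) (qmul (qconj (m21 g)) (m21 g))) Q))
      (qadd (qmul (qconj P) (qsub (qmul (qconj (m11 g)) (m12 g)) (qmul (qconj (m21 g)) (m22 g))))
       (qmul (qconj (qsub (qmul (qconj (m11 g)) (m12 g)) (qmul (qconj (m21 g)) (m22 g)))) Q)))
    (qsub (qmul (qconj (m22 g)) (m22 g)) (qmul (qconj (m12 g)) (m12 g)))).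
  { unfold top, bot. clear. coords. }
  rewrite R1, R2, R3. generalize (qmul (qconj (m21 g)) (m22 g)). clear. coords.
Qed.

Lemma unit_dist (P Q : quat) :
  qnorm2 P = 1 -> qnorm2 (qsub (qmul (qconj P) Q) qone) = qnorm2 (qsub Q P).
Proof.
  intros HP.
  transitivity (qnorm2 P * qnorm2 Q + 1 + qnorm2 (qsub Q P) - qnorm2 Q - qnorm2 P).
  - clear. coords.
  - rewrite HP. ring.
Qed.

Lemma qnorm2_sub_pos (P Q : quat) : P <> Q -> 0 < qnorm2 (qsub P Q).
Proof.
  intros H. destruct (qnorm2_ge0 (qsub P Q)) as [| E]; [assumption |].
  exfalso; apply H. symmetry in E. apply qnorm2_eq0 in E. destruct P, Q; unfold_coords.
  injection E; intros. apply quat_eq; simpl; lra.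
Qed.

(** Invariance of the form makes the norms of the three multipliers [bot] pairwise inverse, hence
    all equal to 1. Then c (P1 - P2) is a difference of two unit quaternions. *)
Lemma three_fixed_points_bound (g : mat2) (P1 P2 P3 : quat) :
  mmul g (msig g) = mone -> mmul (msig g) g = mone ->
  qnorm2 P1 = 1 -> qnorm2 P2 = 1 -> qnorm2 P3 = 1 ->
  P1 <> P2 -> P1 <> P3 -> P2 <> P3 ->
  (forall P, P = P1 \/ P = P2 \/ P = P3 ->
    qadd (qmul (m11 g) P) (m12 g) = qmul P (qadd (qmul (m21 g) P) (m22 g))) ->
  qnorm2 (m21 g) * qnorm2 (qsub P1 P2) <= 4.
Proof.
  intros H1 H2 U1 U2 U3 N12 N13 N23 Hfix.
  set (bot := fun x => qadd (qmul (m21 g) x) (m22 g)).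
  assert (K : forall P Q, qnorm2 P = 1 -> P <> Q ->
    (P = P1 \/ P = P2 \/ P = P3) -> (Q = P1 \/ Q = P2 \/ Q = P3) ->
    qnorm2 (bot P) * qnorm2 (bot Q) = 1).
  { intros P Q HP HPQ HP' HQ'.
    pose proof (sp11_form g P Q H1 H2 (Hfix P HP') (Hfix Q HQ')) as E. cbv zeta in E.
    apply (f_equal qnorm2) in E. rewrite !qnorm2_mul, unit_dist in E by assumption.
    assert (0 < qnorm2 (qsub Q P)) by (apply qnorm2_sub_pos; auto).
    replace (qnorm2 (qconj _)) with (qnorm2 (bot P)) in E by (unfold bot; coords).
    fold (bot Q) in E. apply (Rmult_eq_reg_r (qnorm2 (qsub Q P))); lra. }
  pose proof (K P1 P2 U1 N12 ltac:(auto) ltac:(auto)) as K12.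
  pose proof (K P1 P3 U1 N13 ltac:(auto) ltac:(auto)) as K13.
  pose proof (K P2 P3 U2 N23 ltac:(auto) ltac:(auto)) as K23.
  pose proof (qnorm2_ge0 (bot P1)). pose proof (qnorm2_ge0 (bot P2)). pose proof (qnorm2_ge0 (bot P3)).
  assert (qnorm2 (bot P2) = qnorm2 (bot P3)) by (apply (Rmult_eq_reg_l (qnorm2 (bot P1))); nra).
  assert (qnorm2 (bot P2) = 1) by nra. assert (qnorm2 (bot P1) = 1) by nra.
  rewrite <- qnorm2_mul.
  replace (qmul (m21 g) (qsub P1 P2)) with (qsub (bot P1) (bot P2)) by (unfold bot; coords).
  assert (T : forall x y, qnorm2 (qsub x y) <= 2 * (qnorm2 x + qnorm2 y)).
  { clear. intros x y. pose proof (qnorm2_ge0 (qadd x y)). destruct x, y. unfold_coords. lra. }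
  specialize (T (bot P1) (bot P2)). lra.
Qed.

Lemma abelian_limit_set (G : mat2 -> Prop) :
  is_subgroup_Sp11 G -> (forall g h, G g -> G h -> mmul g h = mmul h g) -> ~ nonelementary G.
Proof.
  intros HG Hab (P1 & P2 & P3 & L1 & L2 & L3 & N12 & N13 & N23).
  destruct (limit_set_seq G P1 L1) as (k & Hk & Hlim).
  pose proof (orbit_norm_cv P1 _ (proj1 L1) Hlim) as He.
  pose proof (qnorm2_sub_pos P1 P2 N12) as HD. set (D := qnorm2 (qsub P1 P2)) in *.
  (* With t = 1 - |o|^2 one has |c|^2 = 1/t - 1, which exceeds the uniform bound 4/D exactly when t
     < D / (D + 4). *)
  destruct (He (D / (D + 4))) as [n Hn]; [apply Rdiv_lt_0_compat; lra |].
  specialize (Hn n (le_n n)). unfold Rdist in Hn. apply Rabs_def2 in Hn.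
  destruct (subgroup_msig G (k n) HG (Hk n)) as (_ & H1 & H2).
  assert (B : qnorm2 (m21 (k n)) * D <= 4).
  { apply (three_fixed_points_bound (k n) P1 P2 P3 H1 H2); try assumption; try apply L1; try apply L2; try apply L3.
    intros P HP. apply (commuting_fixes_limit_point G); [assumption | |].
    - destruct HP as [-> | [-> | ->]]; assumption.
    - intros; apply Hab; auto. }
  pose proof (mact_zero_norm _ H1 H2) as HN.
  destruct (sp11_entries _ H1 H2) as (E1 & E2 & _).
  destruct Hn as [Hn _]. rewrite Rminus_0_r in Hn.
  apply (Rmult_lt_compat_r (D + 4)) in Hn; [| lra].
  replace (D / (D + 4) * (D + 4)) with D in Hn by (field; lra).
  set (t := 1 - _) in *. pose proof (qnorm2_ge0 (m21 (k n))).
  assert (0 < t) by nra. nra.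
Qed.

(** * Exclusion of nonzero X parts *)

(** A line meets the sphere in at most two points: if P1, P1 + w and P1 + t w are on it, then t (t -
    1) = 0. *)
Lemma circle_not_collinear (P1 P2 P3 : quat) :
  qnorm2 P1 = 1 -> qnorm2 P2 = 1 -> qnorm2 P3 = 1 ->
  P1 <> P2 -> P1 <> P3 -> P2 <> P3 ->
  ~ is_real_quat (qmul (qconj (qsub P2 P1)) (qsub P3 P1)).
Proof.
  intros U1 U2 U3 N12 N13 N23 H.
  assert (HD : 0 < qnorm2 (qsub P2 P1)) by (apply qnorm2_sub_pos; auto).
  set (w := qsub P2 P1) in *. set (z := qsub P3 P1) in *.
  set (r := q0 (qmul (qconj w) z)).
  assert (E : qmul (qR (qnorm2 w)) z = qmul (qR r) w).
  { transitivity (qmul w (qmul (qconj w) z)); [clear; coords |].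
    replace (qmul (qconj w) z) with (qR r); [generalize r; clear; coords |].
    destruct H as (E1 & E2 & E3). apply quat_eq; simpl; auto. }
  set (t := r / qnorm2 w).
  assert (Ez : z = qmul (qR t) w).
  { transitivity (qmul (qR (/ qnorm2 w)) (qmul (qR (qnorm2 w)) z)).
    - clear - HD. generalize dependent (qnorm2 w). intros N HN. destruct z; coords_eq; field; lra.
    - rewrite E. unfold t. clear - HD. generalize dependent (qnorm2 w). intros N HN.
      destruct w. coords_eq; field; lra. }
  set (e := q0 (qmul (qconj P1) w)).
  assert (F2 : 2 * e + qnorm2 w = 0).
  { transitivity (qnorm2 P2 - qnorm2 P1); [unfold e, w; clear; coords | lra]. }
  assert (F3 : 2 * (t * e) + t ^ 2 * qnorm2 w = 0).
  { transitivity (2 * q0 (qmul (qconj P1) z) + qnorm2 z).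
    - rewrite Ez. unfold e. generalize t w. clear. coords.
    - transitivity (qnorm2 P3 - qnorm2 P1); [unfold z; clear; coords | lra]. }
  assert (Ht : t * (t - 1) = 0).
  { apply (Rmult_eq_reg_r (qnorm2 w)); [| lra].
    replace e with (- (qnorm2 w / 2)) in F3 by lra. lra. }
  destruct (Rmult_integral _ _ Ht) as [T | T].
  - apply N13. rewrite T in Ez. unfold z in Ez. clear - Ez. destruct P1, P3, w. unfold_coords.
    injection Ez; intros. apply quat_eq; simpl; lra.
  - apply N23. replace t with 1 in Ez by lra. unfold z, w in Ez. clear - Ez.
    destruct P1, P2, P3. unfold_coords. injection Ez; intros. apply quat_eq; simpl; lra.
Qed.

Definition real_traces (G : mat2 -> Prop) : Prop := forall g, G g -> is_real_quat (mtrace g).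

Lemma XYm_inj (x p q s x' p' q' s' : R) (v b c v' b' c' : vec) :
  XYm x p q v s b c = XYm x' p' q' v' s' b' c' ->
  x = x' /\ p = p' /\ q = q' /\ v = v' /\ s = s' /\ b = b' /\ c = c'.
Proof.
  intros H. dest_all. unfold_coords. injection H; intros.
  repeat split; try apply vec_eq; simpl; lra.
Qed.

Lemma no_skew_X (G : mat2 -> Prop) (x s : R) (v b c : vec) :
  is_subgroup_Sp11 G -> real_traces G -> nonelementary G -> G (XYm x 0 0 v s b c) -> v = vzero.
Proof.
  intros HG Htr Hne Hg.
  pose proof (rspan_real_trace_algebra G HG Htr) as HA. set (A := rspan G) in *.
  destruct (classic (v = vzero)) as [| Hv]; [assumption | exfalso].
  destruct (real_trace_decomp A _ HA (rspan_in G _ Hg)) as (x' & p' & q' & v' & s' & b' & c' & E & HX & HY).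
  apply XYm_inj in E. destruct E as (<- & <- & <- & <- & <- & <- & <-).
  destruct (subgroup_msig G _ HG Hg) as (_ & H1 & H2).
  destruct (sp11_skew_X A x s v b c HA HX HY Hv H1 H2) as (-> & Hb & Hc & Hm & Hp).
  destruct (skew_X_forces_planar A v b c HA HX HY Hv Hb Hc Hm Hp) as [KY KX].
  assert (Hform : forall g, G g -> exists x k b c, g = XYm x 0 0 (vscal k v) 0 b c /\
    A (Ym 0 b c) /\ dot v b = 0 /\ dot v c = 0).
  { intros g Hg'.
    destruct (real_trace_decomp A _ HA (rspan_in G _ Hg')) as (x1 & p1 & q1 & v1 & s1 & b1 & c1 & -> & HX1 & HY1).
    destruct (KX _ _ _ HX1) as [-> ->]. destruct (KY _ _ _ HY1) as (-> & Hb1 & Hc1).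
    exists x1, (dot v v1 / dot v v), b1, c1. split; [| auto].
    rewrite <- (cross_eq0_parallel v v1 Hv); [reflexivity |].
    exact (rta_XX A _ _ _ _ _ _ HA HX HX1). }
  refine (abelian_limit_set G HG _ Hne).
  intros g h Hg' Hh'.
  destruct (Hform g Hg') as (x1 & k1 & b1 & c1 & -> & HY1 & Hb1 & Hc1).
  destruct (Hform h Hh') as (x2 & k2 & b2 & c2 & -> & HY2 & Hb2 & Hc2).
  apply (planar_commute A); assumption.
Qed.

(** Over the quaternions only the real part of the trace is cyclic. *)
Lemma retrace_cyclic (M N : mat2) : q0 (mtrace (mmul M N)) = q0 (mtrace (mmul N M)).
Proof. coords. Qed.

(* For [|y| < 1], a multiple of the inversion in the point whose Klein coordinate is [y]. *)
Definition Xpoint (y : quat) : mat2 := Xm (-1) (q0 y) (Vec (q1 y) (q2 y) (q3 y)).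

(** Parallelism of the v parts removes the cross product from the imaginary part; what remains is
    the trace relation of the third element with the commutator of the first two. *)
Lemma Xpoints_collinear (A : mat2 -> Prop) (y1 y2 y3 : quat) :
  real_trace_algebra A -> A (Xpoint y1) -> A (Xpoint y2) -> A (Xpoint y3) ->
  is_real_quat (qmul (qconj (qsub y2 y1)) (qsub y3 y1)).
Proof.
  intros HA HX1 HX2 HX3. unfold Xpoint in *.
  pose proof (rta_XX A _ _ _ _ _ _ HA HX1 HX2) as E12.
  pose proof (rta_XX A _ _ _ _ _ _ HA HX1 HX3) as E13.
  pose proof (rta_XX A _ _ _ _ _ _ HA HX2 HX3) as E23.
  pose proof (rta_XX_comm A _ _ _ _ _ _ HA HX1 HX2) as HY.
  pose proof (rta_XY A _ _ _ _ _ _ HA HX3 HY) as E.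
  apply vec_components in E12, E13, E23, E.
  clear HX1 HX2 HX3 HY HA. dest_all. unfold_coords. repeat split; lra.
Qed.

(** The conjugate h = g X g^-1 is fixed by sigma and has trace zero, so it is some [Xm p' q' v'],
    with normalized centre y. Then y - o = - w / p', where |w| is at most 2 |p| and |p'| is at least
    |d|^2 / |p|. *)
Lemma inversion_conj (A : mat2 -> Prop) (p q : R) (v : vec) (g : mat2) :
  real_trace_algebra A -> A (Xm p q v) -> A g ->
  p ^ 2 = 1 + q ^ 2 + dot v v ->
  mmul g (msig g) = mone -> mmul (msig g) g = mone ->
  let o := mact g qzero in
  exists y, A (Xpoint y) /\
    qnorm2 (qsub y o) <= 4 * p ^ 4 * ((1 - qnorm2 o) * (1 - qnorm2 o)).
Proof.
  intros HA HX Hg Hp H1 H2 o.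
  set (h := mmul g (mmul (Xm p q v) (msig g))).
  assert (Hh : A h) by (apply HA; [| apply HA; [| apply HA]]; assumption).
  assert (Hsig : msig h = h) by (unfold h; generalize g q v; clear; coords).
  assert (Htr : q0 (mtrace h) = 0).
  { unfold h. rewrite retrace_cyclic, <- mmul_assoc, H2, mmul_1r. coords. }
  destruct (real_trace_decomp A h HA Hh) as (x & p' & q' & v' & s & b & c & E & HX' & _).
  assert (Eh : h = Xm p' q' v').
  { rewrite E in Hsig, Htr |- *. clear - Hsig Htr. dest_all. unfold_coords.
    injection Hsig; intros. apply mat2_eq; apply quat_eq; simpl; lra. }
  clear E x s b c.
  destruct (sp11_entries g H1 H2) as (N1 & N2 & N3 & _).
  pose proof (mact_zero_norm g H1 H2) as HN. pose proof (mact_zero_col g H1 H2) as HC.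
  fold o in HN, HC.
  assert (F : qmul o (m22 g) = m12 g).
  { apply mact_zero_mul. pose proof (qnorm2_ge0 (m12 g)). lra. }
  set (n := qvec q v).
  assert (Hn : qnorm2 n = p ^ 2 - 1) by (rewrite Hp; unfold n; generalize q v; clear; coords).
  (* [h = g X g^-1] has lower right entry [-p']; completing the square shows that it is large *)
  assert (Hbig : p * p' = qnorm2 (qsub (qmul (qR p) (m21 g)) (qmul (m22 g) (qconj n))) + qnorm2 (m22 g)).
  { transitivity (- p * q0 (m22 h)); [rewrite Eh; simpl; ring |].
    transitivity (p ^ 2 * (qnorm2 (m21 g) + qnorm2 (m22 g)) - 2 * p * q0 (qmul (m21 g) (qmul n (qconj (m22 g))))).
    - unfold h, n. generalize g q v. clear. coords.
    - transitivity (qnorm2 (qsub (qmul (qR p) (m21 g)) (qmul (m22 g) (qconj n)))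
        + (p ^ 2 - qnorm2 n) * qnorm2 (m22 g)).
      + generalize n g. clear. coords.
      + rewrite Hn. ring. }
  (* By [mact_zero_col], w is (1 - |o|^2) a times a factor of squared norm at most 4 p^2 |d|^2; the
     small parameter compensates this growth. *)
  set (w := qsub (m12 h) (qmul o (m22 h))).
  assert (Hw : qnorm2 w <= 4 * p ^ 2).
  { assert (Ew : w = qmul (qmul (qR (1 - qnorm2 o)) (m11 g))
      (qsub (qmul n (qconj (m22 g))) (qmul (qR p) (qconj (m21 g))))).
    { rewrite <- HC. unfold w, h, n. unfold mmul at 1 2; simpl m12; simpl m22.
      rewrite <- F. generalize o q v. clear. coords. }
    rewrite Ew, !qnorm2_mul, N3.
    replace (qnorm2 (qR (1 - qnorm2 o))) with ((1 - qnorm2 o) * (1 - qnorm2 o))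
      by (generalize (qnorm2 o); clear; coords).
    set (z := qsub _ _).
    assert (Hz : qnorm2 z <= 2 * (qnorm2 n * qnorm2 (m22 g) + p ^ 2 * qnorm2 (m21 g))).
    { pose proof (qnorm2_ge0 (qadd (qmul n (qconj (m22 g))) (qmul (qR p) (qconj (m21 g))))) as K.
      unfold z. revert K. generalize n g. clear. intros. dest_all. unfold_coords. lra. }
    pose proof (qnorm2_ge0 (m21 g)).
    set (t := 1 - qnorm2 o) in *. set (D := qnorm2 (m22 g)) in *.
    assert (0 < t) by nra.
    assert (qnorm2 z <= 4 * p ^ 2 * D) by nra.
    replace (t * t * D * qnorm2 z) with (t * qnorm2 z) by (rewrite <- (Rmult_1_l (t * qnorm2 z)), <- HN; ring).
    apply Rle_trans with (t * (4 * p ^ 2 * D)); [apply Rmult_le_compat_l; lra |].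
    replace (t * (4 * p ^ 2 * D)) with (4 * p ^ 2 * (t * D)) by ring. rewrite HN. lra. }
  set (t := 1 - qnorm2 o) in *. set (D := qnorm2 (m22 g)) in *.
  assert (HD : 1 <= D) by (pose proof (qnorm2_ge0 (m12 g)); lra).
  pose proof (qnorm2_ge0 (qsub (qmul (qR p) (m21 g)) (qmul (m22 g) (qconj n)))) as Hsq.
  assert (Hp' : p' <> 0) by (intros ->; lra).
  (* Scaling by -1/p' brings [Xm p' q' v'] to the normal form with first parameter -1. *)
  exists (qmul (qR (- / p')) (m12 h)). split.
  - replace (Xpoint _) with (mscale (- / p') (Xm p' q' v')) by
      (rewrite Eh; clear - Hp'; destruct v'; unfold Xpoint; coords_eq; field; assumption).
    apply HA, HX'.
  - replace (qsub _ o) with (qmul (qR (- / p')) w).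
    + rewrite qnorm2_mul.
      assert (Hpp : D * D <= p ^ 2 * p' ^ 2) by nra.
      assert (Hinv : qnorm2 (qR (- / p')) = / (p' ^ 2)) by (clear - Hp'; coords_eq; field; assumption).
      rewrite Hinv.
      assert (0 < p' ^ 2) by nra.
      apply (Rmult_le_reg_l (p' ^ 2)); [assumption |].
      rewrite <- Rmult_assoc, Rinv_r, Rmult_1_l by lra.
      apply Rle_trans with (4 * p ^ 2); [assumption |].
      replace (p' ^ 2 * (4 * p ^ 4 * (t * t))) with (4 * p ^ 2 * ((p ^ 2 * p' ^ 2) * (t * t))) by ring.
      rewrite <- (Rmult_1_r (4 * p ^ 2)) at 1. apply Rmult_le_compat_l; [nra |].
      replace 1 with (D * D * (t * t)) by (transitivity ((t * D) * (t * D)); [ring | rewrite HN; ring]).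
      apply Rmult_le_compat_r; nra.
    + unfold w. rewrite Eh. clear - Hp'. generalize o. intros. destruct v'. dest_all. coords_eq; field; assumption.
Qed.

Lemma inversion_limit_point (G A : mat2 -> Prop) (p q : R) (v : vec) (P : quat) :
  is_subgroup_Sp11 G -> real_trace_algebra A -> (forall g, G g -> A g) ->
  A (Xm p q v) -> p ^ 2 = 1 + q ^ 2 + dot v v -> in_limit_set G P ->
  exists y : nat -> quat, (forall n, A (Xpoint (y n))) /\ qlim y P.
Proof.
  intros HG HA Hsub HX Hp HP. destruct (limit_set_seq G P HP) as (k & Hk & Hlim).
  pose proof (orbit_norm_cv P _ (proj1 HP) Hlim) as He.
  assert (K : forall n, exists y, A (Xpoint y) /\ qnorm2 (qsub y (mact (k n) qzero)) <=
    4 * p ^ 4 * ((1 - qnorm2 (mact (k n) qzero)) * (1 - qnorm2 (mact (k n) qzero)))).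
  { intros n. destruct (subgroup_msig G (k n) HG (Hk n)) as (_ & H1 & H2).
    apply (inversion_conj A p q v); auto. }
  apply choice in K. destruct K as [y Hy]. exists y. split; [apply Hy |].
  apply (qlim_of_dist _ _ (fun n => 2 * (4 * p ^ 4 * ((1 - qnorm2 (mact (k n) qzero)) * (1 - qnorm2 (mact (k n) qzero)))
    + qnorm2 (qsub (mact (k n) qzero) P)))).
  - replace 0 with (2 * (4 * p ^ 4 * (0 * 0) + qnorm2 (qsub P P))) by coords.
    apply CV_mult; [apply Un_cv_const |]. apply CV_plus.
    + apply CV_mult; [apply Un_cv_const | apply CV_mult; exact He].
    + apply qlim_norm2, qlim_sub; [exact Hlim | apply qlim_const].
  - intros n. destruct (Hy n) as [_ Hn].
    apply Rle_trans with (2 * (qnorm2 (qsub (y n) (mact (k n) qzero)) + qnorm2 (qsub (mact (k n) qzero) P))); [| lra].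
    generalize (y n) (mact (k n) qzero). clear. intros z o.
    pose proof (qnorm2_ge0 (qsub (qadd z P) (qmul (qR 2) o))). destruct z, o, P. unfold_coords. lra.
Qed.

Lemma no_inversion (G : mat2 -> Prop) (p q : R) (v : vec) :
  is_subgroup_Sp11 G -> real_traces G -> nonelementary G ->
  p <> 0 -> ~ G (Xm p q v).
Proof.
  intros HG Htr (P1 & P2 & P3 & L1 & L2 & L3 & N12 & N13 & N23) Hp Hg.
  pose proof (rspan_real_trace_algebra G HG Htr) as HA.
  assert (Hn : p ^ 2 = 1 + q ^ 2 + dot v v).
  { destruct (subgroup_msig G _ HG Hg) as (_ & H1 & H2).
    assert (E : Xm p q v = XYm 0 p q v 0 vzero vzero) by coords. rewrite E in H1, H2.
    destruct (sp11_relations _ _ _ _ _ _ _ H1 H2) as (_ & _ & _ & En & _).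
    unfold dot, vzero in En; unfold dot; simpl in En; lra. }
  pose proof (fun P => inversion_limit_point G (rspan G) p q v P HG HA (rspan_in G)
    (rspan_in G _ Hg) Hn) as K.
  destruct (K P1 L1) as (y1 & A1 & C1). destruct (K P2 L2) as (y2 & A2 & C2).
  destruct (K P3 L3) as (y3 & A3 & C3).
  apply (circle_not_collinear P1 P2 P3); try assumption; try apply L1; try apply L2; try apply L3.
  (* Collinearity is a closed condition, so it passes from the centres to the limit points. *)
  apply (is_real_qlim (fun n => qmul (qconj (qsub (y2 n) (y1 n))) (qsub (y3 n) (y1 n)))).
  - apply qlim_mul; [apply qlim_conj |]; apply qlim_sub; assumption.
  - intros n. apply (Xpoints_collinear (rspan G)); auto.
Qed.

(** * Groups without X part *)

Definition Em (x s : R) (b c : vec) : mat2 := XYm x 0 0 vzero s b c.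

Lemma real_traces_form (G : mat2 -> Prop) (g : mat2) :
  is_subgroup_Sp11 G -> real_traces G -> nonelementary G -> G g ->
  exists x s b c, g = Em x s b c /\ rspan G (Ym s b c).
Proof.
  intros HG Htr Hne Hg. pose proof (rspan_real_trace_algebra G HG Htr) as HA.
  destruct (real_trace_decomp _ g HA (rspan_in G g Hg)) as (x & p & q & v & s & b & c & -> & HX & HY).
  exists x, s, b, c. split; [| exact HY].
  destruct (subgroup_msig G _ HG Hg) as (_ & H1 & H2).
  destruct (sp11_real_trace_cases _ _ _ _ _ _ _ _ HA HX HY H1 H2) as [[-> ->] | (Hp & -> & -> & -> & ->)].
  - rewrite (no_skew_X G x s v b c HG Htr Hne Hg). reflexivity.
  - exfalso. apply (no_inversion G p q v HG Htr Hne Hp).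
    replace (Xm p q v) with (XYm 0 p q v 0 vzero vzero) by coords. exact Hg.
Qed.

Lemma rspan_Em (G : mat2 -> Prop) (M : mat2) :
  (forall g, G g -> exists x s b c, g = Em x s b c) ->
  rspan G M -> exists x s b c, M = Em x s b c.
Proof.
  intros H HM. induction HM as [g Hg | M N HM IHM HN IHN | t M HM IHM].
  - apply H, Hg.
  - destruct IHM as (x & s & b & c & ->), IHN as (x' & s' & b' & c' & ->).
    exists (x + x'), (s + s'), (vadd b b'), (vadd c c'). unfold Em. coords.
  - destruct IHM as (x & s & b & c & ->).
    exists (t * x), (t * s), (vscal t b), (vscal t c). unfold Em. coords.
Qed.

(** The product is (b x b' - c x c') - (b x c' + b' x c). The first bracket vanishes by the trace
    relation; the second is the X part of an anticommutator, and X parts vanish on the whole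
    span. *)
Lemma sum_diff_parallel (G : mat2 -> Prop) (s s' : R) (b c b' c' : vec) :
  is_subgroup_Sp11 G -> real_traces G -> nonelementary G ->
  rspan G (Ym s b c) -> rspan G (Ym s' b' c') -> cross (vadd b c) (vsub b' c') = vzero.
Proof.
  intros HG Htr Hne HY HY'. pose proof (rspan_real_trace_algebra G HG Htr) as HA.
  pose proof (rta_YY _ _ _ _ _ _ _ HA HY HY') as E1.
  pose proof (rta_YY_anticomm _ _ _ _ _ _ _ HA HY HY') as HX.
  apply rspan_Em in HX.
  - destruct HX as (x & s1 & b1 & c1 & E).
    assert (E2 : vadd (cross b c') (cross b' c) = vzero).
    { set (w := vadd _ _) in *. replace (Xm 0 0 w) with (XYm 0 0 0 w 0 vzero vzero) in E by coords.
      apply XYm_inj in E. apply E. }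
    apply vec_components in E1, E2. clear - E1 E2. dest_all. coords_eq; lra.
  - intros g Hg. destruct (real_traces_form G g HG Htr Hne Hg) as (x & s1 & b1 & c1 & -> & _).
    exists x, s1, b1, c1. reflexivity.
Qed.

(** * Conjugation into SU(1,1) *)

Lemma qinv_unit (h : quat) : qnorm2 h = 1 -> qinv h = qconj h.
Proof. intros H. unfold qinv. rewrite H. destruct h. coords_eq; field. Qed.

(** The half-turn about the bisector of w and the i axis carries w to |w| i, so h can be taken as
    the normalized bisector. *)
Lemma align_to_complex (w : vec) :
  exists h, qnorm2 h = 1 /\
    forall r t, is_complex_quat (qmul (qconj h) (qmul (qvec r (vscal t w)) h)).
Proof.
  destruct w as [x y z].
  (* On the i axis w + |w| i may vanish, but there w is complex already. *)
  destruct (classic (y = 0 /\ z = 0)) as [[-> ->] | Hyz].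
  - exists qone. split; [coords |]. intros r t. unfold is_complex_quat. unfold_coords. lra.
  - set (n := sqrt (x ^ 2 + y ^ 2 + z ^ 2)).
    assert (Hn : n * n = x ^ 2 + y ^ 2 + z ^ 2) by (apply sqrt_sqrt; nra).
    set (N := (x + n) ^ 2 + y ^ 2 + z ^ 2).
    assert (HN : 0 < N).
    { assert (0 < y ^ 2 + z ^ 2) by (destruct (Req_dec y 0); [| nra]; destruct (Req_dec z 0); [tauto | nra]).
      unfold N. nra. }
    clearbody n.
    set (m := / sqrt N).
    assert (Hm : m * m * N = 1).
    { unfold m. pose proof (sqrt_lt_R0 N HN). rewrite <- (sqrt_sqrt N) at 3 by lra. field. lra. }
    clearbody m.
    (* [w + |w| i] intertwines [w] and [|w| i] *)
    exists (qmul (qR m) (Quat 0 (x + n) y z)). split.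
    + rewrite <- Hm. unfold N. coords.
    + intros r t. unfold N in *.
      assert (K2 := f_equal (Rmult (m * m * t * y)) Hn).
      assert (K3 := f_equal (Rmult (m * m * t * z)) Hn).
      unfold is_complex_quat. unfold_coords. split; lra.
Qed.

Lemma madj_mmul (M N : mat2) : madj (mmul M N) = mmul (madj N) (madj M).
Proof. coords. Qed.

Lemma in_Sp11_conj_scal (h : quat) (g : mat2) :
  qnorm2 h = 1 -> in_Sp11 g -> in_Sp11 (mmul (mscal (qconj h)) (mmul g (mscal h))).
Proof.
  intros Hh Hg. unfold in_Sp11 in *.
  set (U := mscal h). set (V := mscal (qconj h)).
  assert (UV : mmul U V = mone).
  { transitivity (mscale (qnorm2 h) mone); [unfold U, V; clear; coords |]. rewrite Hh. coords. }
  assert (VIU : mmul V (mmul I11 U) = I11).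
  { transitivity (mscale (qnorm2 h) I11); [unfold U, V; clear; coords |]. rewrite Hh. coords. }
  rewrite !madj_mmul.
  replace (madj U) with V by (unfold U, V; coords).
  replace (madj V) with U by (unfold U, V; coords).
  replace (mmul I11 (mmul V (mmul g U))) with (mmul V (mmul I11 (mmul g U))).
  - rewrite <- !mmul_assoc, (mmul_assoc U V), UV, mmul_1l, (mmul_assoc I11 g U), (mmul_assoc (madj g)), Hg.
    exact VIU.
  - rewrite !(mmul_assoc _ _ (mmul g U)). f_equal. unfold V. clear. coords.
Qed.

Lemma parallel_conj_SU11 (G : mat2 -> Prop) (w : vec) :
  is_subgroup_Sp11 G ->
  (forall g, G g -> exists x s t k, g = Em x s (vscal t w) (vscal k w)) ->
  exists h, qnorm2 h = 1 /\
    forall g, G g -> in_SU11 (mmul (mscal (qinv h)) (mmul g (mscal h))).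
Proof.
  intros HG H. destruct (align_to_complex w) as (h & Hh & Hc).
  exists h. split; [assumption |]. intros g Hg. rewrite qinv_unit by assumption.
  assert (HS : in_Sp11 g) by (apply HG, Hg).
  destruct (subgroup_msig G g HG Hg) as (_ & H1 & H2).
  destruct (H g Hg) as (x & s & t & k & ->).
  destruct (sp11_relations _ _ _ _ _ _ _ H1 H2) as (_ & _ & _ & En & _).
  split; [apply in_Sp11_conj_scal; assumption |].
  assert (E : forall a b c d, mmul (mscal (qconj h)) (mmul (Mat2 a b c d) (mscal h)) =
    Mat2 (qmul (qconj h) (qmul a h)) (qmul (qconj h) (qmul b h))
         (qmul (qconj h) (qmul c h)) (qmul (qconj h) (qmul d h))) by (clear; coords).
  replace (Em x s (vscal t w) (vscal k w)) with
    (Mat2 (qvec x (vscal t w)) (qvec s (vscal k w)) (qvec s (vscal (- k) w)) (qvec x (vscal (- t) w)))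
    by (unfold Em; clear; coords).
  rewrite E; simpl m11; simpl m12; simpl m21; simpl m22.
  repeat (split; [apply Hc |]).
  (* All entries before conjugation commute, being combinations of 1 and w; the last factor is 1 by
     the norm relation [En]. *)
  transitivity (qR (qnorm2 h * qnorm2 h *
    (x ^ 2 + dot (vscal t w) (vscal t w) - s ^ 2 - dot (vscal k w) (vscal k w)))); [clear; coords |].
  rewrite Hh. apply quat_eq; try reflexivity. simpl.
  unfold dot, vzero in *; simpl in *; lra.
Qed.

(** * Groups fixing a boundary point *)

(* For [e = 1] or [e = -1] these fix the boundary point [-e]. *)
Definition Am (e x s : R) (b : vec) : mat2 := Em x s b (vscal e b).

(** Both x - e s and x + e s are multiplicative, and b follows the cocycle rule of an affine
    group. *)
Lemma Am_mul (e x s x' s' : R) (b b' : vec) :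
  e * e = 1 -> mmul (Am e x s b) (Am e x' s' b') =
  Am e (x * x' + s * s') (x * s' + s * x') (vadd (vscal (x - e * s) b') (vscal (x' + e * s') b)).
Proof.
  intros He. assert (e = 1 \/ e = -1) as [-> | ->].
  { assert (Hz : (e - 1) * (e + 1) = 0) by lra. destruct (Rmult_integral _ _ Hz); lra. }
  all: unfold Am, Em; coords.
Qed.

Lemma Am_sig (e x s : R) (b : vec) : msig (Am e x s b) = Am e x (- s) (vscal (-1) b).
Proof. unfold Am, Em. coords. Qed.

Lemma Am_inj (e x s x' s' : R) (b b' : vec) :
  Am e x s b = Am e x' s' b' -> x = x' /\ s = s' /\ b = b'.
Proof. intros H. apply XYm_inj in H. tauto. Qed.

Lemma Am_det (e x s : R) (b : vec) :
  e * e = 1 -> mmul (Am e x s b) (msig (Am e x s b)) = mone ->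
  (x - e * s) * (x + e * s) = 1.
Proof.
  intros He H. rewrite Am_sig, Am_mul in H by assumption.
  replace mone with (Am e 1 0 vzero) in H by (unfold Am, Em; coords).
  apply Am_inj in H. replace ((x - e * s) * (x + e * s)) with (x * x - e * e * (s * s)) by ring.
  rewrite He. lra.
Qed.

Lemma Am_conj (e x s : R) (b w : vec) :
  e * e = 1 -> (x - e * s) * (x + e * s) = 1 ->
  mmul (mmul (Am e x s b) (Am e 1 0 w)) (msig (Am e x s b)) = Am e 1 0 (vscal ((x - e * s) ^ 2) w).
Proof.
  intros He Hd. rewrite Am_sig, !Am_mul by assumption.
  assert (Hd' : x * x - s * s = 1).
  { transitivity (x * x - e * e * (s * s)); [rewrite He |]; lra. }
  unfold Am. f_equal; [lra | lra | | f_equal]; coords.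
Qed.

Lemma mdist_unipotent (e : R) (w : vec) :
  e * e = 1 -> mdist mone (Am e 1 0 w) = 2 * sqrt (dot w w).
Proof.
  intros He. transitivity (sqrt (2 ^ 2 * dot w w)); [| rewrite sqrt_mult_alt, sqrt_pow2 by lra; reflexivity].
  unfold mdist.
  f_equal. transitivity (2 * dot w w + 2 * (e * e) * dot w w).
  - unfold Am, Em. coords.
  - rewrite He. ring.
Qed.

(** Conjugation by the hyperbolic element contracts w by m = (x - e s)^2, so the iterates approach
    the identity. Discreteness makes one of them trivial, and m is nonzero. *)
Lemma discrete_no_unipotent (G : mat2 -> Prop) (e x s : R) (b w : vec) :
  is_subgroup_Sp11 G -> discrete_set G -> e * e = 1 ->
  G (Am e x s b) -> (x - e * s) ^ 2 < 1 -> G (Am e 1 0 w) -> w = vzero.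
Proof.
  intros HG Hdisc He Hf Hm Hw.
  destruct (subgroup_msig G _ HG Hf) as (Hf' & H1 & _).
  pose proof (Am_det e x s b He H1) as Hd.
  pose proof HG as (_ & Hone & Hmul & _).
  set (m := (x - e * s) ^ 2) in *.
  assert (Hiter : forall n, G (Am e 1 0 (vscal (m ^ n) w))).
  { induction n as [| n IH].
    - replace (vscal (m ^ 0) w) with w; [assumption | coords].
    - replace (vscal (m ^ S n) w) with (vscal m (vscal (m ^ n) w)) by (clear; simpl; coords).
      rewrite <- (Am_conj e x s b) by assumption. auto. }
  destruct (Hdisc mone Hone) as (eps & Heps & Hiso).
  pose proof (sqrt_pos (dot w w)) as HS.
  (* The n-th iterate is at distance 2 m^n |w| from the identity; adding 1 keeps the denominator
     positive even for w = 0. *)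
  destruct (pow_lt_1_zero m) with (y := eps / (2 * sqrt (dot w w) + 1)) as [n Hn].
  { rewrite Rabs_pos_eq; [assumption | unfold m; nra]. }
  { apply Rdiv_lt_0_compat; lra. }
  specialize (Hn n (le_n n)).
  assert (Hm0 : m <> 0) by (unfold m; nra).
  apply (vscal_eq0 (m ^ n) w); [apply pow_nonzero; assumption |].
  assert (E : Am e 1 0 (vscal (m ^ n) w) = mone).
  { apply Hiso; [apply Hiter |]. rewrite mdist_unipotent by assumption.
    replace (dot (vscal (m ^ n) w) (vscal (m ^ n) w)) with ((m ^ n) ^ 2 * dot w w)
      by (generalize (m ^ n); clear; coords).
    rewrite sqrt_mult_alt by nra. rewrite <- (pow2_abs (m ^ n)), sqrt_pow2 by apply Rabs_pos.
    pose proof (Rabs_pos (m ^ n)).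
    apply (Rmult_lt_compat_r (2 * sqrt (dot w w) + 1)) in Hn; [| lra].
    replace (eps / (2 * sqrt (dot w w) + 1) * (2 * sqrt (dot w w) + 1)) with eps in Hn by (field; lra).
    nra. }
  replace mone with (Am e 1 0 vzero) in E by (unfold Am, Em; coords).
  apply Am_inj in E. apply E.
Qed.

(** With s = 0 the determinant gives x^2 = 1, and (o + e) d = e x yields |o + e|^2 = 1 - |o|^2,
    which tends to 0. *)
Lemma affine_limit_point (G : mat2 -> Prop) (e : R) (P : quat) :
  is_subgroup_Sp11 G -> e * e = 1 ->
  (forall g, G g -> exists x b, g = Am e x 0 b) -> in_limit_set G P -> P = qR (- e).
Proof.
  intros HG He H HP. destruct (limit_set_seq G P HP) as (k & Hk & Hlim).
  pose proof (orbit_norm_cv P _ (proj1 HP) Hlim) as Hcv.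
  assert (E : qadd P (qR e) = qzero).
  { apply (qlim_eq0 (fun n => qadd (mact (k n) qzero) (qR e)) _ (fun n => 1 - qnorm2 (mact (k n) qzero)));
      [apply qlim_add; [assumption | apply qlim_const] | assumption |].
    intros n. destruct (subgroup_msig G (k n) HG (Hk n)) as (_ & H1 & H2).
    pose proof (mact_zero_norm _ H1 H2) as HN.
    destruct (sp11_entries _ H1 H2) as (E1 & _). pose proof (qnorm2_ge0 (m12 (k n))).
    assert (F : qmul (mact (k n) qzero) (m22 (k n)) = m12 (k n)) by (apply mact_zero_mul; lra).
    destruct (H (k n) (Hk n)) as (x & b & Ek). rewrite Ek in *.
    pose proof (Am_det e x 0 b He H1) as Hd.
    set (o := mact _ _) in *.
    assert (K : qmul (qadd o (qR e)) (m22 (Am e x 0 b)) = qR (e * x)).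
    { transitivity (qadd (qmul o (m22 (Am e x 0 b))) (qmul (qR e) (m22 (Am e x 0 b))));
        [generalize (m22 (Am e x 0 b)); clear; coords |].
      rewrite F. unfold Am, Em. clear. coords. }
    apply (f_equal qnorm2) in K. rewrite qnorm2_mul in K.
    replace (qnorm2 (qR (e * x))) with 1 in K
      by (symmetry; transitivity (e * e * (x * x)); [clear; coords | rewrite He; lra]).
    apply Req_le, (Rmult_eq_reg_r (qnorm2 (m22 (Am e x 0 b)))); lra. }
  destruct P. unfold_coords. injection E; intros. apply quat_eq; simpl; lra.
Qed.

Lemma affine_parallel (G : mat2 -> Prop) (e : R) :
  is_subgroup_Sp11 G -> discrete_set G -> nonelementary G -> e * e = 1 ->
  (forall g, G g -> exists x s b, g = Am e x s b) ->
  exists w, forall g, G g -> exists x s t k, g = Em x s (vscal t w) (vscal k w).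
Proof.
  intros HG Hdisc Hne He H.
  destruct (classic (exists x s b, G (Am e x s b) /\ s <> 0)) as [(x & s & b & Hg & Hs) | Hno].
  - destruct (subgroup_msig G _ HG Hg) as (Hg' & H1 & _).
    pose proof (Am_det e x s b He H1) as Hd.
    pose proof HG as (_ & _ & Hmul & _).
    assert (Hu : forall w, G (Am e 1 0 w) -> w = vzero).
    { intros w Hw. destruct (Rlt_or_le ((x - e * s) ^ 2) 1) as [Hm | Hm].
      - exact (discrete_no_unipotent G e x s b w HG Hdisc He Hg Hm Hw).
      - rewrite Am_sig in Hg'.
        apply (discrete_no_unipotent G e x (- s) (vscal (-1) b) w HG Hdisc He Hg'); [| assumption].
        replace ((x - e * - s) ^ 2) with ((x + e * s) ^ 2) by ring.
        assert (Hes : e * s <> 0) by (intros E; apply Hs; transitivity (e * e * s); [rewrite He; ring | nra]).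
        set (r := e * s) in *.
        assert (Hp : (x - r) ^ 2 * (x + r) ^ 2 = 1).
        { transitivity (((x - r) * (x + r)) ^ 2); [ring | rewrite Hd; ring]. }
        assert (Hne1 : (x + r) ^ 2 <> 1).
        { intros E1. assert (E2 : (x - r) ^ 2 = 1) by (rewrite E1 in Hp; lra).
          assert (Ex : x * r = 0) by lra. destruct (Rmult_integral _ _ Ex); [subst x; nra | contradiction]. }
        assert (0 <= (x + r) ^ 2) by nra. nra. }
    exists b. intros g Hg2. destruct (H g Hg2) as (x' & s' & b' & ->).
    (* The commutator formed from the two products is unipotent, hence trivial by [Hu]; its vector
       is 2 e (X - e S) times s' b - s b', with nonzero factor. *)
    assert (Hc : vscal (s') b = vscal s b').
    { assert (Hp : G (mmul (Am e x s b) (Am e x' s' b'))) by auto.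
      assert (Hq : G (mmul (Am e x' s' b') (Am e x s b))) by auto.
      rewrite Am_mul in Hp, Hq by assumption.
      replace (x' * x + s' * s) with (x * x' + s * s') in Hq by ring.
      replace (x' * s + s' * x) with (x * s' + s * x') in Hq by ring.
      set (X := x * x' + s * s') in *. set (S := x * s' + s * x') in *.
      destruct (subgroup_msig G _ HG Hp) as (_ & D1 & _). apply Am_det in D1; [| assumption].
      destruct (subgroup_msig G _ HG Hq) as (Hq' & _). rewrite Am_sig in Hq'.
      pose proof (Hmul _ _ Hp Hq') as Hpq. rewrite Am_mul in Hpq by assumption.
      replace (X * X + S * - S) with 1 in Hpq
        by (transitivity (X * X - e * e * (S * S)); [lra | rewrite He; ring]).
      replace (X * - S + S * X) with 0 in Hpq by ring.
      apply Hu in Hpq.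
      assert (Hz : vscal (2 * e * (X - e * S)) (vsub (vscal s' b) (vscal s b')) = vzero).
      { rewrite <- Hpq. generalize X S. clear. coords. }
      apply vscal_eq0 in Hz.
      2: { repeat apply Rmult_integral_contrapositive_currified; [lra | |];
           intros E0; rewrite E0 in *; lra. }
      apply vec_components in Hz. clear - Hz. dest_all. coords_eq; lra. }
    exists x', s', (s' / s), (e * (s' / s)).
    assert (Eb : b' = vscal (s' / s) b).
    { transitivity (vscal (/ s) (vscal s b')).
      - clear - Hs. destruct b'. coords_eq; field; assumption.
      - rewrite <- Hc. clear - Hs. destruct b. coords_eq; field; assumption. }
    rewrite Eb. unfold Am. f_equal. generalize (s' / s). clear. coords.
  - exfalso. destruct Hne as (P1 & P2 & P3 & L1 & L2 & _ & N12 & _).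
    apply N12. transitivity (qR (- e)); [| symmetry]; apply (affine_limit_point G); try assumption.
    all: intros g Hg; destruct (H g Hg) as (x & s & b & ->); exists x, b;
      destruct (Req_dec s 0) as [-> |]; [reflexivity |]; exfalso; apply Hno; eauto.
Qed.

(** * From SU(1,1) back to real traces *)

Lemma SU11_real_trace (M : mat2) : in_SU11 M -> is_real_quat (mtrace M).
Proof.
  intros (HS & Ha & Hb & Hc & Hd & Hdet). apply msig_mul_l in HS.
  destruct M as [[a0 a1 a2 a3] [b0 b1 b2 b3] [c0 c1 c2 c3] [d0 d1 d2 d3]].
  unfold is_complex_quat in *. simpl in Ha, Hb, Hc, Hd.
  destruct Ha as [-> ->], Hb as [-> ->], Hc as [-> ->], Hd as [-> ->].
  unfold_coords. injection HS; clear HS; intros. injection Hdet; clear Hdet; intros.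
  split; [| lra].
  (* [a^* = a^* (a d - b c) = (|a|^2 - |c|^2) d = d] *)
  assert (N : a0 * a0 + a1 * a1 - c0 * c0 - c1 * c1 = 1) by lra.
  assert (E0 : a0 * b0 + a1 * b1 - c0 * d0 - c1 * d1 = 0) by lra.
  assert (E1 : a0 * b1 - a1 * b0 - c0 * d1 + c1 * d0 = 0) by lra.
  assert (D0 : a0 * d0 - a1 * d1 - (b0 * c0 - b1 * c1) = 1) by lra.
  assert (D1 : a0 * d1 + a1 * d0 - (b0 * c1 + b1 * c0) = 0) by lra.
  apply (f_equal (Rmult d1)) in N. apply (f_equal (Rmult c1)) in E0.
  apply (f_equal (Rmult c0)) in E1. apply (f_equal (Rmult a1)) in D0.
  apply (f_equal (Rmult a0)) in D1. clear - N E0 E1 D0 D1. lra.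
Qed.

Lemma conj_real (h x : quat) :
  qnorm2 h = 1 -> is_real_quat (qmul (qconj h) (qmul x h)) -> is_real_quat x.
Proof.
  intros Hh H. set (y := qmul (qconj h) (qmul x h)) in *.
  replace x with (qmul h (qmul y (qconj h))).
  - generalize dependent y. intros y (E1 & E2 & E3). destruct y as [r y1 y2 y3]. simpl in E1, E2, E3.
    subst. clear. destruct h. unfold_coords. repeat split; ring.
  - transitivity (qmul (qR (qnorm2 h * qnorm2 h)) x); [unfold y; clear; coords |].
    rewrite Hh. coords.
Qed.

Lemma real_trace_field (G : mat2 -> Prop) :
  real_traces G -> forall x, in_trace_field G x -> is_real_quat x.
Proof.
  intros HG x Hx. unfold is_real_quat.
  induction Hx as [r | g Hg | x y _ IHx _ IHy | x _ IHx | x y _ IHx _ IHy | x _ IHx _].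
  - repeat split.
  - apply HG, Hg.
  - destruct x, y; simpl in *; lra.
  - destruct x; simpl in *; lra.
  - destruct x, y; simpl in *. destruct IHx as (-> & -> & ->), IHy as (-> & -> & ->).
    repeat split; ring.
  - destruct x; simpl in *. destruct IHx as (-> & -> & ->). unfold Rdiv. repeat split; ring.
Qed.

(** * Parallel vectors and the equivalence *)

(** If some b + c and some b - c are nonzero on the span, [sum_diff_parallel] makes every difference
    parallel to one sum u, and then one nonzero difference makes every sum parallel to u. Otherwise
    c = b or c = -b throughout, the affine case. *)
Lemma real_traces_parallel (G : mat2 -> Prop) :
  is_subgroup_Sp11 G -> discrete_set G -> nonelementary G -> real_traces G ->
  exists w, forall g, G g -> exists x s t k, g = Em x s (vscal t w) (vscal k w).
Proof.
  intros HG Hdisc Hne Htr.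
  pose proof (fun g Hg => real_traces_form G g HG Htr Hne Hg) as HF.
  destruct (classic (exists s b c, rspan G (Ym s b c) /\ vadd b c <> vzero)) as [(s1 & b1 & c1 & HY1 & Hp) | Hno].
  - destruct (classic (exists s b c, rspan G (Ym s b c) /\ vsub b c <> vzero)) as [(s2 & b2 & c2 & HY2 & Hm) | Hno].
    + set (u := vadd b1 c1) in *.
      assert (Hsub : forall s b c, rspan G (Ym s b c) -> exists t, vsub b c = vscal t u).
      { intros s b c HY. exists (dot u (vsub b c) / dot u u).
        apply cross_eq0_parallel; [assumption |].
        exact (sum_diff_parallel G _ _ _ _ _ _ HG Htr Hne HY1 HY). }
      destruct (Hsub _ _ _ HY2) as [t2 Ht2].
      exists u. intros g Hg. destruct (HF g Hg) as (x & s & b & c & -> & HY).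
      destruct (Hsub _ _ _ HY) as [t Ht].
      assert (Hc : cross u (vadd b c) = vzero).
      { apply (vscal_eq0 t2).
        - intros ->. apply Hm. rewrite Ht2. coords.
        - pose proof (sum_diff_parallel G _ _ _ _ _ _ HG Htr Hne HY HY2) as E. rewrite Ht2 in E.
          apply vec_components in E. clear - E. generalize dependent u. intros u E.
          dest_all. coords_eq; lra. }
      apply (cross_eq0_parallel u _ Hp) in Hc. set (k := dot u (vadd b c) / dot u u) in *.
      exists x, s, ((k + t) / 2), ((k - t) / 2).
      clearbody k u. apply vec_components in Ht, Hc. clear - Ht Hc.
      f_equal; dest_all; coords_eq; lra.
    + apply (affine_parallel G 1); try assumption; [lra |].
      intros g Hg. destruct (HF g Hg) as (x & s & b & c & -> & HY). exists x, s, b.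
      unfold Am. f_equal. destruct (classic (vsub b c = vzero)) as [E | E];
        [| exfalso; apply Hno; eauto].
      apply vec_components in E. clear - E. dest_all. coords_eq; lra.
  - apply (affine_parallel G (-1)); try assumption; [lra |].
    intros g Hg. destruct (HF g Hg) as (x & s & b & c & -> & HY). exists x, s, b.
    unfold Am. f_equal. destruct (classic (vadd b c = vzero)) as [E | E];
      [| exfalso; apply Hno; eauto].
    apply vec_components in E. clear - E. dest_all. coords_eq; lra.
Qed.

Theorem theorem4p4 (G : mat2 -> Prop) :
  is_subgroup_Sp11 G -> discrete_set G -> nonelementary G ->
  ((forall x, in_trace_field G x -> is_real_quat x) <->
   (exists h : quat, qnorm2 h = 1 /\
      forall g, G g -> in_SU11 (mmul (mscal (qinv h)) (mmul g (mscal h))))).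
Proof.
  intros HG Hdisc Hne. split.
  - intros H.
    assert (Htr : real_traces G) by (intros g Hg; apply H, tf_trace, Hg).
    destruct (real_traces_parallel G HG Hdisc Hne Htr) as [w Hw].
    exact (parallel_conj_SU11 G w HG Hw).
  - intros (h & Hh & H). apply real_trace_field. intros g Hg.
    specialize (H g Hg). rewrite qinv_unit in H by assumption. apply SU11_real_trace in H.
    apply (conj_real h _ Hh).
    (* A scalar matrix conjugates entry by entry, so the trace is conjugated by h. *)
    replace (qmul (qconj h) (qmul (mtrace g) h)) with (mtrace (mmul (mscal (qconj h)) (mmul g (mscal h))))
      by (clear; coords).
    exact H.
Qed.
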